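(* Let $\alpha,q\in(-1,1)$ and $n\ge1$. For any $\mathbf x=(x_1,\dots,x_n)\in H_{\mathbb R}^n$ and any $\epsilon=(\epsilon(1),\dots,\epsilon(n))\in\{1,\ast,\prime\}^n$, $$b_{\alpha,q}^{\epsilon(n)}(x_n)\cdots b_{\alpha,q}^{\epsilon(1)}(x_1)\Omega=\sum_{\pi_f\in\mathcal P^B_{E;\epsilon}(n)}\alpha^{\mathrm{Narc}(\pi_f)}\,q^{\mathrm{rc}(\pi)+\mathrm{MaxC}(\pi)+2\,\mathrm{rnarc}(\pi_f)+2\,\mathrm{MaxL}(\pi_f)}\;\mathrm R^{\mathbf x}_{\pi_f}\,\widehat{\mathrm R}^{\mathbf x}_{\pi_f},$$ where the sum over the empty set is $0$.
   Context: **Operators.** $H_{\mathbb R}$ is a separable real Hilbert space, $H$ its complexification, with inner product $\langle\cdot,\cdot\rangle$ linear in the right and antilinear in the left argument; $x\mapsto\bar x$ is a fixed bounded linear selfadjoint operator on $H$ whose square is the identity. $\mathcal F_{\rm fin}(H)=\bigoplus_{n\ge0}H^{\otimes n}$ is the algebraic full Fock space, $H^{\otimes0}=\mathbb C\Omega$. $(T_x)_{x\in H_{\mathbb R}}$ is a fixed family of bounded selfadjoint operators on $H$. For $x\in H_{\mathbb R}$ ($\check x_k$ means the factor is omitted, and $0^0=1$): - $b^{\ast}_{\alpha,q}(x)(x_1\otimes\cdots\otimes x_n)=x_1\otimes\cdots\otimes x_n\otimes x$ for $n\ge 1$, $b^{\ast}_{\alpha,q}(x)\Omega=x$; - $b^{1}_{\alpha,q}(x)\Omega=0$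 and, for $n\ge1$, $b^{1}_{\alpha,q}(x)(x_1\otimes\cdots\otimes x_n)=\sum_{k=1}^n q^{n-k}\langle x,x_k\rangle x_1\otimes\cdots\otimes\check x_k\otimes\cdots\otimes x_n+\alpha q^{n-1}\sum_{k=1}^nq^{k-1}\langle x,\bar x_k\rangle x_1\otimes\cdots\otimes\check x_k\otimes\cdots\otimes x_n$; - $b^{\prime}_{\alpha,q}(x)\Omega=0$ and, for $n\ge1$, $b^{\prime}_{\alpha,q}(x)(x_1\otimes\cdots\otimes x_n)=\sum_{k=1}^n q^{n-k}x_1\otimes\cdots\otimes\check x_k\otimes\cdots\otimes x_n\otimes T_x(x_k)+\alpha q^{n-1}\sum_{k=1}^nq^{k-1}x_1\otimes\cdots\otimes\check x_k\otimes\cdots\otimes x_n\otimes T_x(\bar x_k)$. **Extended type-B partitions.** For a set partition $\pi$ of $[n]=\{1,\dots,n\}$, an arc is a pair $\{i,j\}$, $i<j$, of elements of one block such that $j$ is the smallest element of that block greater than $i$. $\mathcal P^B(n)$ is the set of pairs $\pi_f=(\pi,f)$ with $\pi$ a set partition of $[n]$ and $f$ assigning a color in $\{\pm1\}$ to each arc and color $1$ to each singleton. A block $B=\{i_1<\dots<i_m\}$ is written $B_c$, $c=(c_1,\dots,c_{m-1})$, with $c_j$ the color of the arc $\{i_j,i_{j+1}\}$. $\mathcal P^B_E(n)$ is the set of all objects obtained from some $\pi_f\in\mathcal P^B(n)$ by choosing an arbitrary (possibly empty) set of blocks of size at least two and marking them by $\prime$. For $\pi_f\in\mathcal P^B_E(n)$: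 $\mathrm{Block}'(\pi_f)$ is the set of marked blocks, $\mathrm{Sing}(\pi)$ the set of singleton blocks, $\mathrm{Block}(\pi_f)$ the set of unmarked blocks of size at least two. $\mathrm{Arc}(\pi_f)$ is the set of all arcs (of marked and unmarked blocks), $\mathrm{Arc}(\pi_f,-1)$ the set of those with color $-1$. For $\epsilon\in\{1,\ast,\prime\}^n$, $\mathcal P^B_{E;\epsilon}(n)$ is the set of $\pi_f\in\mathcal P^B_E(n)$ compatible with $\epsilon$, meaning that for each $i\in[n]$: $\epsilon(i)=\ast$ iff $i$ is the minimum of its block (singletons included); $\epsilon(i)=1$ iff $i$ is the maximum of a block in $\mathrm{Block}(\pi_f)$; $\epsilon(i)=\prime$ iff $i$ is neither the minimum nor the maximum of its block, or $i$ is the maximum of a block in $\mathrm{Block}'(\pi_f)$. **Statistics** (marks on blocks are ignored for $\mathrm{rc}$, $\mathrm{rnarc}$, $\mathrm{Narc}$). - $\mathrm{rc}(\pi)$: number of unordered pairs of arcs from distinct blocks which cross, where $\{i,j\}$ and $\{i',j'\}$ cross if $i<i'<j<j'$ or $i'<i<j'<j$. - $\mathrm{rnarc}(\pi_f)$: number of pairs of arcs $(V,W)$ from distinct blocks such that $V$ nests $W$ and $W$ has color $-1$, where $\{i,j\}$ nests $\{i',j'\}$ if $i<i'<j'<j$. - $\mathrm{Narc}(\pi_f)=\#\mathrm{Arc}(\pi_f,-1)$. - $\mathrm{MaxC}(\pi)$: number of pairs $(V,W)\in[\mathrm{Block}'(\pi_f)\cup\mathrm{Sing}(\pi)]\times\mathrm{Arc}(\pi_f)$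 with $W=\{i,j\}$ and $i<\max(V)<j$. - $\mathrm{MaxL}(\pi_f)$: number of pairs $(V,W)\in[\mathrm{Block}'(\pi_f)\cup\mathrm{Sing}(\pi)]\times\mathrm{Arc}(\pi_f,-1)$ with $\max(V)<j$ for all $j\in W$. **Weights.** For a block $B_c=\{i_1<\dots<i_m\}_{(c_1,\dots,c_{m-1})}$ let $f_j:H\to H$ be $f_j(x)=x$ if $c_j=1$, $f_j(x)=\bar x$ if $c_j=-1$. Put $\widehat{\mathbf T}^{\mathbf x}_{B_c}=I$ if $B_c$ is a singleton, $\widehat{\mathbf T}^{\mathbf x}_{B_c}=T_{x_{i_m}}f_{m-1}\cdots f_3T_{x_{i_3}}f_2T_{x_{i_2}}f_1$ if $B_c\in\mathrm{Block}'(\pi_f)$; and for $B_c\in\mathrm{Block}(\pi_f)$ put $\mathbf T^{\mathbf x}_{B_c}=f_1$ if $m=2$ and $\mathbf T^{\mathbf x}_{B_c}=f_{m-1}T_{x_{i_{m-1}}}\cdots f_3T_{x_{i_3}}f_2T_{x_{i_2}}f_1$ if $m>2$. Then $$\mathrm R^{\mathbf x}_{\pi_f}=\prod_{B_c\in\mathrm{Block}(\pi_f)}\langle x_{\max(B_c)},\mathbf T^{\mathbf x}_{B_c}x_{\min(B_c)}\rangle,\qquad \widehat{\mathrm R}^{\mathbf x}_{\pi_f}=\bigotimes_{B_c\in\mathrm{Block}'(\pi_f)\cup\mathrm{Sing}(\pi)}\widehat{\mathbf T}^{\mathbf x}_{B_c}x_{\min(B_c)},$$ where the tensor factors are ordered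 from left to right by increasing $\max(B_c)$; an empty product equals $1$, and $\widehat{\mathrm R}^{\mathbf x}_{\pi_f}=\Omega$ if $\mathrm{Block}'(\pi_f)\cup\mathrm{Sing}(\pi)=\emptyset$. *)

(* Defs.v *)
From HB Require Import structures.
From mathcomp Require Import all_boot all_order all_algebra.
From mathcomp Require Import ring_quotient sesquilinear.
From mathcomp Require Import boolp classical_sets cardinality reals topology normedtype.
From mathcomp Require Import complex ring.
From mathcomp Require Import multinomials.freeg.
Import Order.TTheory GRing.Theory Num.Theory.
Import numFieldNormedType.Exports.

Set Implicit Arguments.
Unset Strict Implicit.
Unset Printing Implicit Defensive.

Local Open Scope ring_scope.
Local Open Scope quotient_scope.

(** The algebraic full Fock space [fock V] is the free module on finite words
    [w = [:: h_1; ...; h_n]] of vectors (all lengths [n] at once), divided by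
    linearity in each letter.  The relations preserve the length of words, so
    the quotient is the direct sum over [n] of the algebraic tensor powers;
    length 0 carries no relation and contributes the line spanned by the
    vacuum. *)

Definition del (A : Type) (k : nat) (w : seq A) : seq A :=
  take k w ++ drop k.+1 w.

Section Fock.
Variables (K : comNzRingType) (V : lmodType K).

Definition multilinear (W : lmodType K) (g : seq V -> W) : Prop :=
  forall (u : seq V) (a : K) (x y : V) (v : seq V),
    g (u ++ (a *: x + y) :: v) = a *: g (u ++ x :: v) + g (u ++ y :: v).

Definition relator (u : seq V) (a : K) (x y : V) (v : seq V)
    : {freeg (seq V) / K} :=
  << u ++ (a *: x + y) :: v >> - a *: << u ++ x :: v >> - << u ++ y :: v >>.

Inductive relator_span : {freeg (seq V) / K} -> Prop :=
| relator_span0 : relator_span 0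
| relator_spanD c u a x y v z :
    relator_span z -> relator_span (c *: relator u a x y v + z).

Definition in_relator_span : {pred {freeg (seq V) / K}} :=
  fun z => `[< relator_span z >].

Lemma relator_span_add z1 z2 :
  relator_span z1 -> relator_span z2 -> relator_span (z1 + z2).
Proof.
move=> h1 h2; elim: h1 => [|c u a x y v z _ IH]; first by rewrite add0r.
by rewrite -addrA; apply: relator_spanD.
Qed.

Lemma relator_span_scale b z : relator_span z -> relator_span (b *: z).
Proof.
elim=> [|c u a x y v w _ IH]; first by rewrite scaler0; apply: relator_span0.
by rewrite scalerDr scalerA; apply: relator_spanD.
Qed.

Lemma in_relator_span_zmod_closed : zmod_closed in_relator_span.
Proof.
split=> [|z1 z2 /asboolP h1 /asboolP h2]; apply/asboolP.
  exact: relator_span0.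
by apply: relator_span_add => //; rewrite -scaleN1r; apply: relator_span_scale.
Qed.

HB.instance Definition _ :=
  GRing.isZmodClosed.Build _ in_relator_span in_relator_span_zmod_closed.

Definition fock : Type := Quotient.quot in_relator_span.
HB.instance Definition _ := Choice.on fock.
HB.instance Definition _ := GRing.Zmodule.on fock.

Definition fock_pi (z : {freeg (seq V) / K}) : fock :=
  \pi_(Quotient.quot in_relator_span) z.
Definition fock_repr (t : fock) : {freeg (seq V) / K} :=
  repr (t : Quotient.quot in_relator_span).

Lemma fock_reprK t : fock_pi (fock_repr t) = t.
Proof. exact: reprK. Qed.

Lemma fock_piD : {morph fock_pi : z1 z2 / z1 + z2}.
Proof. exact: Quotient.pi_add. Qed.

Lemma fock_piB : {morph fock_pi : z1 z2 / z1 - z2}.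
Proof.
move=> z1 z2; rewrite fock_piD; congr (_ + _); exact: Quotient.pi_opp.
Qed.

Lemma fock_pi_eq z1 z2 : fock_pi z1 = fock_pi z2 <-> relator_span (z1 - z2).
Proof.
split=> [/eqP|h].
  by rewrite /fock_pi -Quotient.idealrBE => /asboolP.
by apply/eqP; rewrite /fock_pi -Quotient.idealrBE; apply/asboolP.
Qed.

Definition fock_scale (a : K) (t : fock) : fock := fock_pi (a *: fock_repr t).

Lemma fock_scale_pi a z : fock_scale a (fock_pi z) = fock_pi (a *: z).
Proof.
apply/fock_pi_eq; rewrite -scalerBr; apply: relator_span_scale.
by apply/fock_pi_eq; rewrite fock_reprK.
Qed.

Lemma fock_scaleA a b t : fock_scale a (fock_scale b t) = fock_scale (a * b) t.
Proof. by rewrite -[t]fock_reprK !fock_scale_pi scalerA. Qed.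

Lemma fock_scale1 : left_id 1 fock_scale.
Proof. by move=> t; rewrite -[t]fock_reprK fock_scale_pi scale1r. Qed.

Lemma fock_scaleDr : right_distributive fock_scale +%R.
Proof.
move=> a s t; rewrite -[s]fock_reprK -[t]fock_reprK.
by rewrite -fock_piD !fock_scale_pi scalerDr fock_piD.
Qed.

Lemma fock_scaleDl t : {morph fock_scale^~ t : a b / a + b}.
Proof.
by move=> a b; rewrite -[t]fock_reprK !fock_scale_pi scalerDl fock_piD.
Qed.

HB.instance Definition _ := GRing.Zmodule_isLmodule.Build K fock
  fock_scaleA fock_scale1 fock_scaleDr fock_scaleDl.

(** [tens [:: h_1; ...; h_n]] is h_1 ⊗ ... ⊗ h_n. *)
Definition tens (w : seq V) : fock := fock_pi << w >>.
Definition vacuum : fock := tens [::].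

Lemma tens_multilinear : multilinear tens.
Proof.
move=> u a x y v; rewrite /tens -[a *: fock_pi _]/(fock_scale _ _).
rewrite fock_scale_pi -fock_piD; apply/fock_pi_eq.
rewrite opprD addrA -[_ - _ - _]addr0 -[X in X + 0]scale1r.
by apply: relator_spanD; apply: relator_span0.
Qed.

(** The linear extension to the Fock space of a function given on pure tensors;
    it is meaningful when [g] is multilinear. *)
Definition fock_lift (W : lmodType K) (g : seq V -> W) (t : fock) : W :=
  fglift g (fock_repr t).

Section Lift.
Variables (W : lmodType K) (g : seq V -> W) (g_multi : multilinear g).

Let fgliftB : {morph (fglift g : {freeg (seq V) / K} -> W) : z1 z2 / z1 - z2}.
Proof. exact: lift_is_additive. Qed.

Let fglift0 : fglift g (0 : {freeg (seq V) / K}) = 0.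
Proof. by rewrite -(subrr 0) fgliftB subrr. Qed.

Let fgliftD : {morph (fglift g : {freeg (seq V) / K} -> W) : z1 z2 / z1 + z2}.
Proof.
move=> z1 z2; have -> : z1 + z2 = z1 - (0 - z2) by rewrite sub0r opprK.
by rewrite !fgliftB fglift0 sub0r opprK.
Qed.

Let fgliftZ a (z : {freeg (seq V) / K}) : fglift g (a *: z) = a *: fglift g z.
Proof.
rewrite -[z in RHS]freeg_sumE [a *: z]/(fgscale a z) /fgscale.
elim: (dom z) => [|w s IH]; first by rewrite !big_nil fglift0 scaler0.
by rewrite !big_cons !fgliftD IH !liftU scalerDr scalerA.
Qed.

Let fglift_span z : relator_span z -> fglift g z = 0.
Proof.
elim=> [|c u a x y v w _ IH]; first exact: fglift0.
rewrite fgliftD IH addr0 fgliftZ /relator !fgliftB fgliftZ !liftU !scale1r.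
by rewrite g_multi addrAC addrK subrr scaler0.
Qed.

Lemma fock_lift_pi z : fock_lift g (fock_pi z) = fglift g z.
Proof.
apply/eqP; rewrite -subr_eq0 -fgliftB; apply/eqP/fglift_span.
by apply/fock_pi_eq; rewrite fock_reprK.
Qed.

Lemma fock_lift_tens w : fock_lift g (tens w) = g w.
Proof. by rewrite fock_lift_pi liftU scale1r. Qed.

Lemma fock_lift_linear : linear (fock_lift g).
Proof.
move=> a s t; rewrite -[s]fock_reprK -[t]fock_reprK.
rewrite -[a *: fock_pi _]/(fock_scale _ _) fock_scale_pi -fock_piD.
by rewrite !fock_lift_pi fgliftD fgliftZ.
Qed.
End Lift.

Lemma multilinear_add (W : lmodType K) (g h : seq V -> W) :
  multilinear g -> multilinear h -> multilinear (fun w => g w + h w).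
Proof.
by move=> mg mh u a x y v; rewrite mg mh scalerDr addrACA.
Qed.

Lemma multilinear_scale (W : lmodType K) (c : nat -> K) (g : seq V -> W) :
  multilinear g -> multilinear (fun w => c (size w) *: g w).
Proof.
move=> mg u a x y v; rewrite mg !size_cat /= scalerDr !scalerA.
by rewrite [a * _]mulrC.
Qed.

Lemma multilinear_rcons (x : V) : multilinear (fun w => tens (rcons w x)).
Proof.
move=> u a y z v; rewrite !rcons_cat !rcons_cons; exact: tens_multilinear.
Qed.

Lemma multilinear_sum_del (W : lmodType K) (c : nat -> nat -> K)
    (m : V -> seq V -> W) :
  (forall w, linear (m^~ w)) -> (forall x, multilinear (m x)) ->
  multilinear (fun w =>
    \sum_(k < size w) c (size w) k *: m w`_k (del k w)).
Proof.
move=> m1 m2 u a x y v; rewrite !size_cat /= scaler_sumr -big_split /=.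
apply: eq_bigr => k _; rewrite scalerA [a * _]mulrC -scalerA -scalerDr.
congr (_ *: _); rewrite /del !nth_cat !take_cat !drop_cat.
have [ltku|ltuk|->] := ltngtP k (size u).
- have [_|h|->] := ltngtP k.+1 (size u).
  + by rewrite !catA m2.
  + by rewrite ltnS leqNgt ltku in h.
  + by rewrite subnn /= m2.
- rewrite [(k.+1 < _)%N]ltnNge (ltnW (ltnW ltuk : size u < k.+1)%N) /= subSn ?(ltnW ltuk) //=.
  move: ltuk; rewrite -subn_gt0.
  by case: (k - size u)%N => // j _ /=; rewrite -!catA !cat_cons m2.
- by rewrite ltnNge leqnSn /= subSnn subnn /= !cats0 !drop0 m1.
Qed.

End Fock.

Local Open Scope complex_scope.

Section Complexification.
Variables (R : realType) (HR : completeNormedModType R).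

Definition complexification : Type := (HR * HR)%type.
HB.instance Definition _ := Choice.on complexification.
HB.instance Definition _ := GRing.Zmodule.on complexification.

(** The pair [(u, v)] stands for u + iv. *)
Definition cscale (a : R[i]) (h : complexification) : complexification :=
  (complex.Re a *: h.1 - complex.Im a *: h.2,
   complex.Re a *: h.2 + complex.Im a *: h.1).

Lemma cscaleA a b h : cscale a (cscale b h) = cscale (a * b) h.
Proof.
case: a b h => [a1 a2] [b1 b2] [u v]; rewrite /cscale /=; congr (_, _).
  rewrite scalerBr scalerDr !scalerA scalerBl scalerDl !opprD.
  by rewrite [X in _ + X = _]addrC addrACA.
rewrite scalerBr scalerDr !scalerA scalerBl scalerDl.
by rewrite [X in _ + X = _]addrC addrACA.
Qed.

Lemma cscale1 : left_id 1 cscale.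
Proof. by case=> u v; rewrite /cscale /= !scale1r !scale0r subr0 addr0. Qed.

Lemma cscaleDr : right_distributive cscale +%R.
Proof.
move=> a [u v] [u' v']; rewrite /cscale /=; congr (_, _).
  by rewrite !scalerDr opprD addrACA.
by rewrite !scalerDr addrACA.
Qed.

Lemma cscaleDl h : {morph cscale^~ h : a b / a + b}.
Proof.
case: h => u v [a1 a2] [b1 b2]; rewrite /cscale /=; congr (_, _).
  by rewrite !scalerDl opprD addrACA.
by rewrite !scalerDl addrACA.
Qed.

HB.instance Definition _ := GRing.Zmodule_isLmodule.Build R[i] complexification
  cscaleA cscale1 cscaleDr cscaleDl.

Definition embed (u : HR) : complexification := (u, 0).

Variable ip : {dot HR for idfun}.

(** Sesquilinear extension of [ip], antilinear on the left, linear on the right. *)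
Definition cip (h k : complexification) : R[i] :=
  (ip h.1 k.1 + ip h.2 k.2) +i* (ip h.1 k.2 - ip h.2 k.1).

Definition cnorm (h : complexification) : R := Num.sqrt (complex.Re (cip h h)).

Definition bounded_op (A : complexification -> complexification) : Prop :=
  exists M : R, forall h, cnorm (A h) <= M * cnorm h.

Definition selfadjoint_op (A : complexification -> complexification) : Prop :=
  forall h k, cip (A h) k = cip h (A k).

Lemma cip_linear h : linear (cip h : complexification -> R[i]^o).
Proof.
move=> [a1 a2] [u v] [u' v'].
apply/eqP; rewrite eq_complex; apply/andP; split; apply/eqP => /=;
  rewrite !(linearB, linearD, linearZ) /= /GRing.scale /=; ring.
Qed.

End Complexification.

Variant letter := One | Star | Prime.

Definition letter_eqb (a b : letter) : bool :=
  match a, b with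
  | One, One | Star, Star | Prime, Prime => true
  | _, _ => false
  end.

Lemma letter_eqP : eq_axiom letter_eqb.
Proof. by do 2!case; constructor. Qed.

HB.instance Definition _ := hasDecEq.Build letter letter_eqP.

Section Operators.
Variables (R : realType) (HR : completeNormedModType R).
Local Notation H := (complexification HR).
Local Notation F := (fock H).
Variables (ip : {dot HR for idfun}) (bar : {linear H -> H}).
Variables (T : HR -> {linear H -> H}) (alpha q : R).
Implicit Types (x : HR) (w : seq H) (t : F).

(** Each operator is the linear extension of its formula on a pure tensor
    [tens w]; the letters of [w] are numbered from 0, so that [k] is one less
    than the position in [w]. *)

Definition creation_word x w : F := tens (rcons w (embed x)).

Definition annihilation_word x w : F :=
  (\sum_(k < size w)
     ((q ^+ (size w - k.+1))%:C * cip ip (embed x) w`_k) *: tens (del k w))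
  + (alpha * q ^+ (size w).-1)%:C *:
    (\sum_(k < size w)
       ((q ^+ k)%:C * cip ip (embed x) (bar w`_k)) *: tens (del k w)).

Definition gauge_word x w : F :=
  (\sum_(k < size w)
     (q ^+ (size w - k.+1))%:C *: tens (rcons (del k w) (T x w`_k)))
  + (alpha * q ^+ (size w).-1)%:C *:
    (\sum_(k < size w)
       (q ^+ k)%:C *: tens (rcons (del k w) (T x (bar w`_k)))).

Definition creation x : F -> F := fock_lift (creation_word x).
Definition annihilation x : F -> F := fock_lift (annihilation_word x).
Definition gauge x : F -> F := fock_lift (gauge_word x).

Definition b_op (e : letter) : HR -> F -> F :=
  match e with
  | Star => creation
  | One => annihilation
  | Prime => gauge
  end.

Lemma creation_word_multilinear x : multilinear (creation_word x).
Proof. exact: multilinear_rcons. Qed.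

Lemma cip_tens_sum_multilinear (A : {linear H -> H}) (c : nat -> nat -> R[i]) x :
  multilinear (fun w => \sum_(k < size w)
    (c (size w) k * cip ip (embed x) (A w`_k)) *: tens (del k w)).
Proof.
pose m (h : H) w : F := cip ip (embed x) (A h) *: tens w.
have m1 w : linear (m^~ w).
  move=> a h k; rewrite /m linearP cip_linear scalerDl.
  by rewrite [a *: cip _ _ _]/(a * _) scalerA.
have m2 h : multilinear (m h).
  move=> u a y z v; rewrite /m tens_multilinear scalerDr !scalerA.
  by rewrite [a * _]mulrC.
rewrite (_ : (fun w => _) =
    fun w => \sum_(k < size w) c (size w) k *: m w`_k (del k w)).
  exact: multilinear_sum_del.
by apply/funext => w; apply: eq_bigr => k _; rewrite scalerA.
Qed.

Lemma tens_sum_multilinear (A : {linear H -> H}) (c : nat -> nat -> R[i]) :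
  multilinear (fun w => \sum_(k < size w)
    c (size w) k *: tens (rcons (del k w) (A w`_k))).
Proof.
apply: (multilinear_sum_del c (m := fun h w => tens (rcons w (A h)))) => [w|h].
  by move=> a y z; rewrite linearP -!cats1 tens_multilinear.
exact: multilinear_rcons.
Qed.

Lemma annihilation_word_multilinear x : multilinear (annihilation_word x).
Proof.
apply: multilinear_add.
  exact: (cip_tens_sum_multilinear idfun (fun n k => (q ^+ (n - k.+1))%:C)).
apply: (multilinear_scale (fun n => (alpha * q ^+ n.-1)%:C)).
exact: (cip_tens_sum_multilinear bar (fun n k => (q ^+ k)%:C)).
Qed.

Lemma gauge_word_multilinear x : multilinear (gauge_word x).
Proof.
apply: multilinear_add.
  exact: (tens_sum_multilinear (T x) (fun n k => (q ^+ (n - k.+1))%:C)).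
apply: (multilinear_scale (fun n => (alpha * q ^+ n.-1)%:C)).
exact: (tens_sum_multilinear (T x \o bar) (fun n k => (q ^+ k)%:C)).
Qed.

Lemma creation_tens x w : creation x (tens w) = creation_word x w.
Proof. exact/fock_lift_tens/creation_word_multilinear. Qed.

Lemma annihilation_tens x w : annihilation x (tens w) = annihilation_word x w.
Proof. exact/fock_lift_tens/annihilation_word_multilinear. Qed.

Lemma gauge_tens x w : gauge x (tens w) = gauge_word x w.
Proof. exact/fock_lift_tens/gauge_word_multilinear. Qed.

Lemma annihilation_vacuum x : annihilation x (vacuum H) = 0.
Proof.
by rewrite annihilation_tens /annihilation_word !big_ord0 scaler0 addr0.
Qed.

Lemma gauge_vacuum x : gauge x (vacuum H) = 0.
Proof. by rewrite gauge_tens /gauge_word !big_ord0 scaler0 addr0. Qed.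

Lemma b_op_linear e x : linear (b_op e x).
Proof.
case: e; apply: fock_lift_linear.
- exact: annihilation_word_multilinear.
- exact: creation_word_multilinear.
- exact: gauge_word_multilinear.
Qed.

End Operators.

(** A partition of ['I_n] with colored arcs and marked blocks: [blocks] is the
    underlying family of blocks, [negarcs] the set of arcs of color -1 (all the
    other arcs and all the singletons have color 1), [marked] the set of blocks
    carrying the mark ′.  An arc {i, j} with i < j is the pair [(i, j)]. *)
Record epart (n : nat) := EPart {
  blocks : {set {set 'I_n}};
  negarcs : {set 'I_n * 'I_n};
  marked : {set {set 'I_n}}
}.

Section ExtendedPartitions.
Variable n : nat.

Definition epart_pack (t : {set {set 'I_n}} * {set 'I_n * 'I_n} * {set {set 'I_n}})
  : epart n := EPart t.1.1 t.1.2 t.2.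
Definition epart_unpack (p : epart n) := (blocks p, negarcs p, marked p).
Lemma epart_unpackK : cancel epart_unpack epart_pack. Proof. by case. Qed.
HB.instance Definition _ := Finite.copy (epart n) (can_type epart_unpackK).

Implicit Types (B : {set 'I_n}) (i j : 'I_n) (a b : 'I_n * 'I_n).
Implicit Types (P : {set {set 'I_n}}) (p : epart n) (eps : 'I_n -> letter).

Definition arcs P : {set 'I_n * 'I_n} :=
  [set a | [exists B in P, [&& a.1 \in B, a.2 \in B, (a.1 < a.2)%N
    & [forall j in B, (a.1 < j)%N ==> (a.2 <= j)%N]]]].

Definition nonsingletons P : {set {set 'I_n}} := [set B in P | (1 < #|B|)%N].
Definition singletons P : {set {set 'I_n}} := [set B in P | #|B| == 1%N].

Definition extended_partitions : {set epart n} :=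
  [set p | [&& finset.partition (blocks p) [set: 'I_n],
               negarcs p \subset arcs (blocks p)
             & marked p \subset nonsingletons (blocks p)]].

Definition unmarked p : {set {set 'I_n}} := nonsingletons (blocks p) :\: marked p.

(** The blocks which contribute a tensor factor: Block' ∪ Sing. *)
Definition open_blocks p : {set {set 'I_n}} := marked p :|: singletons (blocks p).

Definition bmax B : nat := \max_(i in B) (i : nat).
Definition is_min i B : bool := (i \in B) && [forall j in B, (i <= j)%N].
Definition is_max i B : bool := (i \in B) && [forall j in B, (j <= i)%N].

Definition compatible eps p : bool :=
  [forall i, let B := finset.pblock (blocks p) i in
    [&& (eps i == Star) == is_min i B,
        (eps i == One) == (B \in unmarked p) && is_max i B
      & (eps i == Prime) == (~~ is_min i B && ~~ is_max i B)
                            || (B \in marked p) && is_max i B]].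

Definition compatible_partitions eps : {set epart n} :=
  [set p in extended_partitions | compatible eps p].

Definition distinct_blocks P a b : bool := finset.pblock P a.1 != finset.pblock P b.1.

Definition crosses a b : bool :=
  [&& a.1 < b.1, b.1 < a.2 & a.2 < b.2]%N || [&& b.1 < a.1, a.1 < b.2 & b.2 < a.2]%N.

Definition nests a b : bool := [&& a.1 < b.1, b.1 < b.2 & b.2 < a.2]%N.

(** Unordered pairs of arcs are two-element sets of arcs. *)
Definition rc p : nat :=
  #|[set [set ab.1; ab.2] | ab in finset.setX (arcs (blocks p)) (arcs (blocks p))
      & distinct_blocks (blocks p) ab.1 ab.2 && crosses ab.1 ab.2]|.

Definition rnarc p : nat :=
  #|[set ab in finset.setX (arcs (blocks p)) (negarcs p)
      | distinct_blocks (blocks p) ab.1 ab.2 && nests ab.1 ab.2]|.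

Definition Narc p : nat := #|negarcs p|.

Definition MaxC p : nat :=
  #|[set Ba in finset.setX (open_blocks p) (arcs (blocks p))
      | (Ba.2.1 < bmax Ba.1)%N && (bmax Ba.1 < Ba.2.2)%N]|.

Definition MaxL p : nat :=
  #|[set Ba in finset.setX (open_blocks p) (negarcs p)
      | (bmax Ba.1 < Ba.2.1)%N && (bmax Ba.1 < Ba.2.2)%N]|.

End ExtendedPartitions.

Section Weights.
Variables (R : realType) (HR : completeNormedModType R).
Local Notation H := (complexification HR).
Variables (ip : {dot HR for idfun}) (bar : {linear H -> H}).
Variables (T : HR -> {linear H -> H}) (n : nat) (x : 'I_n -> HR).
Implicit Types (p : epart n) (i j : 'I_n) (s : seq 'I_n) (B : {set 'I_n}).

Definition flip p (a : 'I_n * 'I_n) (h : H) : H :=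
  if a \in negarcs p then bar h else h.

(** [marked_op p i s] and [unmarked_op p i s] are the operators attached to a
    marked (or singleton) and to an unmarked block whose elements are, in
    increasing order, [i :: s].  The last arc of an unmarked block contributes
    its map f but no operator T. *)
Fixpoint marked_op p i s (h : H) : H :=
  match s with
  | [::] => h
  | j :: s' => marked_op p j s' (T (x j) (flip p (i, j) h))
  end.

Fixpoint unmarked_op p i s (h : H) : H :=
  match s with
  | [::] => h
  | [:: j] => flip p (i, j) h
  | j :: s' => unmarked_op p j s' (T (x j) (flip p (i, j) h))
  end.

(** [enum B] lists [B] in increasing order; the values at the empty set are
    irrelevant, since blocks are nonempty. *)
Definition unmarked_weight p B : R[i] :=
  match enum B with
  | [::] => 1
  | i :: s => cip ip (embed (x (last i s))) (unmarked_op p i s (embed (x i)))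
  end.

Definition open_vector p B : H :=
  match enum B with
  | [::] => 0
  | i :: s => marked_op p i s (embed (x i))
  end.

Definition scalar_weight p : R[i] :=
  \prod_(B in unmarked p) unmarked_weight p B.

Definition tensor_weight p : fock H :=
  tens [seq open_vector p B
       | B <- sort (fun A B => (bmax A <= bmax B)%N) (enum (open_blocks p))].

End Weights.

(* Main.v *)
Require Import Defs.
From mathcomp Require Import all_boot all_order all_algebra.
From mathcomp Require Import sesquilinear.
From mathcomp Require Import boolp classical_sets cardinality reals topology normedtype.
From mathcomp Require Import complex.
From mathcomp Require Import fintype finset zify ring.
Import Order.TTheory GRing.Theory Num.Theory.
Import numFieldNormedType.Exports.
Set Implicit Arguments.
Unset Strict Implicit.
Unset Printing Implicit Defensive.
Local Open Scope ring_scope.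
Local Open Scope complex_scope.

(** The proof reads the product from the right, one letter at a time, and keeps
    a closed formula for the vector obtained so far.

    After the letters with index in an initial segment D, that vector is the sum,
    over the extended partitions of D compatible with those letters, of the very
    terms that the theorem sums over partitions of the whole index set.  The
    tensor factors of a term belong to its open blocks (marked blocks and
    singletons), which are the blocks that a later letter may still enlarge; they
    stand in the order of their maxima, because a block reaches the right end of
    the word each time it receives an element.

    Let m be the next index.  A letter * creates the singleton block of m.  A
    letter 1 or ′ picks a tensor factor, that is an open block V, joins m to V by
    an arc whose color says whether the conjugation is applied, and then either
    closes the block, which yields an inner product, or moves it to the right end
    as a marked block.  Conversely a compatible partition of D and m determines V,
    the color and the partition of D: this is [sum_stage].

    It remains to compare powers of q.  Let t = max V, and let the open blocks
    with larger and smaller maximum than V be counted by [above] and [below].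
    - An arc around t counted V in MaxC; it crosses the new arc, since its
      right end comes before m.  So MaxC loses to rc what V contributed, and it
      gains the [above] open blocks whose maximum lies under the new arc
      ([rc_MaxC_ext]).
    - A negative arc to the right of t counted V in MaxL; it is nested by the
      new arc.  So MaxL loses to rnarc what V contributed, and if the new arc is
      negative it gains the [below] open blocks whose maximum lies left of that
      arc ([rnarc_MaxL_ext]).
    If V is the k-th of N open blocks, then [above] is N - k and [below] is k - 1
    ([index_open_order]); hence the color 1 contributes q ^ (N - k) and the color
    -1 contributes alpha q ^ (N - k + 2 (k - 1)) = alpha q ^ (N - 1) q ^ (k - 1),
    which are the coefficients in the definition of the operators
    ([b_op_stage]). *)

(** * Arcs of a partition and insertion of a largest point *)

Section Blocks.
Variable n : nat.
Implicit Types (i j m : 'I_n) (a : 'I_n * 'I_n) (B V D : {set 'I_n}).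
Implicit Types (P : {set {set 'I_n}}).

Lemma is_maxP j B :
  reflect (j \in B /\ forall i, i \in B -> (i <= j)%N) (is_max j B).
Proof.
apply: (iffP andP) => -[jB h]; split=> //; first by move=> i iB; exact: (forall_inP h).
exact/forall_inP.
Qed.

Lemma is_minP j B :
  reflect (j \in B /\ forall i, i \in B -> (j <= i)%N) (is_min j B).
Proof.
apply: (iffP andP) => -[jB h]; split=> //; first by move=> i iB; exact: (forall_inP h).
exact/forall_inP.
Qed.

Lemma is_max_inj B i j : is_max i B -> is_max j B -> i = j.
Proof.
move=> /is_maxP [iB hi] /is_maxP [jB hj].
by apply/val_inj/anti_leq; rewrite /= hi // hj.
Qed.

Lemma bmaxE B j : is_max j B -> bmax B = j.
Proof.
move=> /is_maxP [jB h]; apply/anti_leq/andP; split; first exact/bigmax_leqP.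
exact: (leq_bigmax_cond j).
Qed.

Lemma sorted_enum_set B : sorted (fun i j => (i < j)%N) (enum B).
Proof.
apply: (@subseq_sorted _ _ _ _ (enum 'I_n)); first by move=> x y z; apply: ltn_trans.
  by rewrite enumT; apply: filter_subseq.
rewrite -(@sorted_map _ _ val ltn) val_enum_ord; exact: iota_ltn_sorted.
Qed.

Lemma enum_setU1_top m V : (forall i, i \in V -> (i < m)%N) ->
  enum (m |: V) = rcons (enum V) m.
Proof.
move=> hV; apply: (@irr_sorted_eq _ (fun i j : 'I_n => (i < j)%N)).
- by move=> x y z; apply: ltn_trans.
- by move=> x; apply: ltnn.
- exact: sorted_enum_set.
- have tr : transitive (fun i j : 'I_n => (i < j)%N).
    by move=> x y z; apply: ltn_trans.
  rewrite sorted_pairwise // pairwise_rcons -sorted_pairwise //.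
  rewrite sorted_enum_set andbT; apply/allP => i; rewrite mem_enum; exact: hV.
- by move=> i; rewrite mem_rcons in_cons !mem_enum in_setU1.
Qed.

(** The default value makes [top m V] usable at every V, in particular without
    a proof that V is nonempty; on the empty set it is m. *)
Definition top m V := last m (enum V).

Lemma top_max m V : V != set0 -> is_max (top m V) V.
Proof.
rewrite /top -cards_eq0 cardE => hV.
have h := sorted_enum_set V.
apply/is_maxP.
have mE : V =i enum V by move=> i; rewrite mem_enum.
case/lastP: (enum V) hV h mE => // s j _ h mE.
rewrite last_rcons; split; first by rewrite mE mem_rcons mem_head.
move=> i; rewrite mE mem_rcons in_cons => /orP [/eqP -> //|iS].
move: h; rewrite sorted_pairwise; last by move=> x y z; apply: ltn_trans.
by rewrite pairwise_rcons => /andP [/allP h _]; apply/ltnW/h.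
Qed.

Lemma bmax_top m V : V != set0 -> bmax V = top m V.
Proof. by move=> /(top_max m) /bmaxE. Qed.

Lemma is_max_setU1_top m V : (forall i, i \in V -> (i < m)%N) ->
  is_max m (m |: V).
Proof.
move=> hV; apply/is_maxP; split; first exact: setU11.
by move=> i /setU1P [-> //|/hV /ltnW].
Qed.

Lemma bmax_setU1_top m V : (forall i, i \in V -> (i < m)%N) ->
  bmax (m |: V) = m.
Proof. by move=> /is_max_setU1_top /bmaxE. Qed.

Lemma partition_same P D B B' i : partition P D -> B \in P -> B' \in P ->
  i \in B -> i \in B' -> B = B'.
Proof.
move=> /and3P [_ tr _] BP BP' iB iB'.
by rewrite -(def_pblock tr BP iB) (def_pblock tr BP' iB').
Qed.

Lemma partition_neq0 P D B : partition P D -> B \in P -> B != set0.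
Proof. by move=> /and3P [_ _ h] BP; apply: contraNneq h => <-. Qed.

Lemma partition_mem P D B i : partition P D -> B \in P -> i \in B -> i \in D.
Proof. by move=> /and3P [/eqP <- _ _] BP iB; apply/bigcupP; exists B. Qed.

Lemma arcsP P a :
  reflect (exists B, [/\ B \in P, a.1 \in B, a.2 \in B, (a.1 < a.2)%N
                       & forall j, j \in B -> (a.1 < j)%N -> (a.2 <= j)%N])
          (a \in arcs P).
Proof.
rewrite inE; apply: (iffP exists_inP).
  case=> B BP /and4P [h1 h2 h3 /forall_inP h].
  by exists B; split=> // j jB; apply/implyP/h.
case=> B [BP h1 h2 h3 h]; exists B => //; apply/and4P; split=> //; apply/forall_inP => j jB; apply/implyP; exact: h.
Qed.

(** V is either a block of P or the empty set.  Admitting the empty set lets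
    one construction cover both the enlargement of a block and the creation of
    the singleton of m; in the second case removing V from P changes nothing.
    *)
Definition add_block m P V : {set {set 'I_n}} := (m |: V) |: (P :\ V).

(** The blocks other than V partition the complement of V, and V with m is
    disjoint from them. *)
Lemma partition_add m P D V : partition P D -> m \notin D ->
  V \in set0 |: P -> partition (add_block m P V) (m |: D).
Proof.
move=> pP i0D; rewrite /add_block => /setU1P [->|VP].
  have -> : P :\ set0 = P.
    by apply/setDidPl; rewrite disjoint_sym disjoints1; case/and3P: pP.
  rewrite setU0; apply: partitionU1 => //; first by rewrite -card_gt0 cards1.
  by rewrite disjoints1.
have -> : m |: D = (m |: V) :|: (D :\: V).
  apply/setP => i; rewrite !inE.
  by case iV: (i \in V); rewrite ?orbT ?orbF //= (partition_mem pP VP iV) orbT.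
apply: partitionU1; first exact: partitionD1.
  by apply/set0Pn; exists m; exact: setU11.
rewrite disjoints_subset; apply/subsetP => i; rewrite !inE => /orP [/eqP ->|->] //.
by rewrite negb_and i0D orbT.
Qed.

(** The arcs ending at m; there are none when V is empty, which is why this is
    a set and not an arc. *)
Definition new_arcs m V : {set 'I_n * 'I_n} :=
  [set a | is_max a.1 V && (a.2 == m)].

Lemma new_arcs0 m : new_arcs m set0 = set0.
Proof. by apply/setP => a; rewrite !inE /is_max inE. Qed.

Lemma new_arcsE m V : V != set0 -> new_arcs m V = [set (top m V, m)].
Proof.
move=> hV; have h := top_max m hV; apply/setP => -[a1 a2]; rewrite !inE /= xpair_eqE.
by apply: andb_id2r => _; apply/idP/eqP => [h1|-> //]; exact: is_max_inj h1 h.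
Qed.

(** The point m is larger than every point of D, so it comes after all
    consecutive pairs of V and leaves them consecutive; the only pair it can
    form is with the maximum of V. *)
Lemma arcs_add m P D V : partition P D -> (forall i, i \in D -> (i < m)%N) ->
  V \in set0 |: P -> arcs (add_block m P V) = new_arcs m V :|: arcs P.
Proof.
move=> pP hD VP.
have Vlt i : i \in V -> (i < m)%N.
  by case/setU1P: VP => [->|VP iV]; [rewrite inE|apply/hD/(partition_mem pP VP)].
have Plt B i : B \in P -> i \in B -> (i < m)%N.
  by move=> BP iB; apply/hD/(partition_mem pP BP).
apply/setP => a; rewrite in_setU; apply/idP/orP.
- move=> /arcsP [B [/setU1P [-> /setU1P [e|a1V]|/setD1P [BV BP] h1] h2 h3 h]].
  + by case/setU1P: h2 h3 => [->|/Vlt h2]; rewrite e ?ltnn // ltnNge (ltnW h2).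
  + case/setU1P: h2 => [e2|a2V].
      left; rewrite inE e2 eqxx andbT; apply/is_maxP; split=> // j jV.
      rewrite leqNgt; apply/negP => lt.
      by have := h j (setU1r _ jV) lt; rewrite e2 leqNgt Vlt.
    right; apply/arcsP; exists V; split=> //; last first.
      by move=> j jV; apply: h; exact: setU1r.
    by case/setU1P: VP => // V0; rewrite V0 inE in a1V.
  + by right; apply/arcsP; exists B.
- case=> [|/arcsP [B [BP h1 h2 h3 h]]].
    rewrite inE => /andP [/is_maxP [a1V h] /eqP e]; apply/arcsP; exists (m |: V).
    split; rewrite ?e ?setU11 ?setU1r //; first exact: Vlt.
    by move=> j /setU1P [-> //|/h h1 h2]; have := leq_ltn_trans h1 h2; rewrite ltnn.
  apply/arcsP; have [BV|BV] := eqVneq B V.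
    exists (m |: V); split; rewrite ?setU11 ?setU1r // -?BV //.
    by move=> j /setU1P [-> _|/h //]; apply/ltnW/(Plt B).
  by exists B; split=> //; apply/setU1r/setD1P.
Qed.

(** Inverse of [add_block]: if the block of m is a singleton it disappears,
    otherwise it loses m. *)
Definition rem_block m P : {set {set 'I_n}} :=
  let B := pblock P m in
  if B :\ m == set0 then P :\ B else (B :\ m) |: (P :\ B).

Lemma pblock_add m P D V : partition P D -> m \notin D ->
  V \in set0 |: P -> pblock (add_block m P V) m = m |: V.
Proof.
move=> pP hD VP; have /and3P [_ tr _] := partition_add pP hD VP.
by apply: def_pblock => //; exact: setU11.
Qed.

Lemma add_notin m P D V : partition P D -> m \notin D ->
   V \in set0 |: P -> (m \notin V) * ((m |: V) \notin P).
Proof.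
move=> pP hD VP; split.
  by case/setU1P: VP => [->|VP]; [rewrite inE|apply: contra hD => /(partition_mem pP VP)].
by apply: contra hD => /(partition_mem pP); apply; exact: setU11.
Qed.

Lemma add_blockK m P D V : partition P D -> m \notin D ->
  V \in set0 |: P -> rem_block m (add_block m P V) = P.
Proof.
move=> pP hD VP; rewrite /rem_block (pblock_add pP hD VP).
have [i0V BP] := add_notin pP hD VP.
rewrite setU1K // /add_block.
have -> : ((m |: V) |: P :\ V) :\ (m |: V) = P :\ V.
  by rewrite setU1K // inE negb_and BP orbT.
case: eqP => [V0|/eqP V0]; last first.
  by rewrite setD1K //; case/setU1P: VP => // e; rewrite e eqxx in V0.
by rewrite V0; apply/setDidPl; rewrite disjoint_sym disjoints1; case/and3P: pP.
Qed.

Lemma partition_pblock m P D : partition P (m |: D) ->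
  pblock P m \in P /\ m \in pblock P m.
Proof.
case/and3P=> [/eqP cP tr _].
have h : m \in cover P by rewrite cP setU11.
by rewrite pblock_mem // mem_pblock.
Qed.

Lemma partition_rem m P D : partition P (m |: D) -> m \notin D ->
  [/\ partition (rem_block m P) D,
      pblock P m :\ m \in set0 |: rem_block m P
    & add_block m (rem_block m P) (pblock P m :\ m) = P].
Proof.
move=> pP hD; have [BP iB] := partition_pblock pP.
rewrite /rem_block; set B := pblock P m in BP iB *; set V := B :\ m.
have BV : m |: V = B by rewrite /V setD1K.
have pP1 := partitionD1 pP BP.
have subB j : j \in B -> j \in m |: D by exact: partition_mem pP BP.
have VD j : j \in V -> j \in D.
  by case/setD1P => ji /subB /setU1P [/eqP|//]; rewrite (negPf ji).
have e1 : (m |: D) :\: B = D :\: V.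
  apply/setP => j; rewrite !inE negb_and negbK; case: eqP => [->|] //=.
  by rewrite iB (negPf hD).
have VP : V \notin P :\ B \/ V = set0.
  have [->|V0] := eqVneq V set0; [by right|left].
  rewrite !inE negb_and negbK.
  case: (boolP (V \in P)) => VP; last by rewrite orbT.
  case/set0Pn: V0 => j jV; have jB : j \in B by rewrite -BV setU1r.
  by rewrite (partition_same pP VP BP jV jB) eqxx.
case: eqP => [V0|/eqP V0].
  rewrite V0 setU11; split=> //; first by move: pP1; rewrite e1 V0 setD0.
  rewrite /add_block -V0 BV.
  suff -> : P :\ B :\ V = P :\ B by rewrite setD1K.
  by apply/setDidPl; rewrite disjoint_sym disjoints1 V0; case/and3P: pP1.
case: VP => [VP|e]; last by rewrite e eqxx in V0.
split; last by rewrite /add_block BV setU1K // setD1K.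
  have -> : D = V :|: (D :\: V).
    apply/setP => j; rewrite in_setU in_setD.
    by have [/VD ->|_] := boolP (j \in V).
  apply: partitionU1 => //; first by rewrite -e1.
  by rewrite disjoint_sym disjoints_subset; apply/subsetP => j; rewrite !inE; case/andP.
by rewrite setU1r // setU11.
Qed.

End Blocks.

(** * Extended partitions of an initial segment *)

Section Stages.
Variable n : nat.
Implicit Types (i j m : 'I_n) (a : 'I_n * 'I_n) (B V D : {set 'I_n}).
Implicit Types (P : {set {set 'I_n}}) (p : epart n) (eps : 'I_n -> letter).

(** The unique letter that compatibility allows at the element i of the block
    B. *)
Definition letter_at p B i : letter :=
  if is_min i B then Star
  else if (B \in marked p) || ~~ is_max i B then Prime else One.

(** Compatibility with eps, but for partitions of an initial segment D of the
    index set.  A block that meets D in at least two points is marked here as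
    long as it is open, even if a later letter 1 is to close it without a
    mark. *)
Definition stage eps D p : bool :=
  [&& partition (blocks p) D, negarcs p \subset arcs (blocks p),
      marked p \subset nonsingletons (blocks p)
    & [forall B in blocks p, forall i in B, eps i == letter_at p B i]].

Lemma stageP eps D p :
  reflect [/\ partition (blocks p) D, {subset negarcs p <= arcs (blocks p)},
              forall B, B \in marked p -> B \in blocks p /\ (1 < #|B|)%N
            & forall B i, B \in blocks p -> i \in B -> eps i = letter_at p B i]
          (stage eps D p).
Proof.
apply: (iffP and4P) => [[h1 /subsetP h2 /subsetP h3 /forall_inP h4]|[h1 h2 h3 h4]].
  split=> //; first by move=> B /h3; rewrite inE => /andP.
  by move=> B i BP iB; apply/eqP/(forall_inP (h4 B BP)).
split=> //; try exact/subsetP.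
  by apply/subsetP => B /h3 [h5 h6]; rewrite inE h5.
by apply/forall_inP => B BP; apply/forall_inP => i iB; apply/eqP/h4.
Qed.

(** The three equivalences that define compatibility at i exclude each other
    and exhaust all cases, because marked blocks are not singletons; so they
    amount to a single value for eps i. *)
Lemma compatible_stage eps p :
  (p \in compatible_partitions eps) = stage eps [set: 'I_n] p.
Proof.
rewrite inE [_ \in extended_partitions _]inE /stage -andbA.
case: (boolP (partition (blocks p) [set: 'I_n])) => // pP.
rewrite -andbA !andTb.
case: (negarcs p \subset _) => //=.
case: (boolP (marked p \subset _)) => //= /subsetP hM.
have /and3P [/eqP cP tr _] := pP.
have E B i : B \in blocks p -> i \in B ->
   [&& (eps i == Star) == is_min i B,
        (eps i == One) == (B \in unmarked p) && is_max i B
      & (eps i == Prime) == (~~ is_min i B && ~~ is_max i B)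
                            || (B \in marked p) && is_max i B]
   = (eps i == letter_at p B i).
  move=> BP iB; rewrite /letter_at.
  have -> : (B \in unmarked p) = (B \notin marked p) && (1 < #|B|)%N by rewrite !inE BP.
  have hB : (B \in marked p) -> (1 < #|B|)%N by move=> /hM; rewrite inE => /andP [].
  (* An element that is both minimum and maximum is alone in its block, and one
     that is not the minimum has company. *)
  have mm : is_min i B -> is_max i B -> (1 < #|B|)%N = false.
    move=> /is_minP [_ h1] /is_maxP [_ h2]; apply/negbTE; rewrite -leqNgt.
    apply/card_le1_eqP => x y xB yB; apply/val_inj/anti_leq => /=.
    by rewrite (leq_trans (h2 x xB)) ?(leq_trans (h2 y yB)) ?h1.
  have nm : ~~ is_min i B -> (1 < #|B|)%N.
    rewrite ltnNge; apply: contra => /card_le1_eqP h; apply/is_minP; split=> // j jB.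
    by rewrite (h i j).
  case: (boolP (is_min i B)) mm nm => _; last first.
    move=> _ /(_ isT) ->; rewrite andbT.
    by case: (is_max i B); case: (B \in marked p); case: (eps i).
  move=> mm _; case: (boolP (B \in marked p)) hB => _.
    by move=> /(_ isT) h; case: (is_max i B) mm => [/(_ isT isT)|_]; rewrite ?h; case: (eps i).
  move=> _; case: (is_max i B) mm => [/(_ isT isT) ->|_]; rewrite ?andbF; by case: (eps i).
apply/forallP/forall_inP => h.
  move=> B BP; apply/forall_inP => i iB; rewrite -E //.
  by have := h i; rewrite /= (def_pblock tr BP iB).
move=> i /=; have ic : i \in cover (blocks p) by rewrite cP inE.
have BP := pblock_mem ic; rewrite E ?mem_pblock //.
by apply: (forall_inP (h _ BP)); rewrite mem_pblock.
Qed.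

Lemma open_blocksE eps D p B : stage eps D p ->
  (B \in open_blocks p) = (B \in blocks p) && ((B \in marked p) || (#|B| == 1%N)).
Proof.
move=> /stageP [_ _ hM _]; rewrite !inE; case: (boolP (B \in blocks p)) => //= BP.
by rewrite orbF; apply: contraNF BP => /hM [].
Qed.

Lemma open_blocks_sub eps D p B : stage eps D p -> B \in open_blocks p -> B \in blocks p.
Proof. by move=> st; rewrite (open_blocksE _ st) => /andP []. Qed.

(** The point m joins V and the new arc, if any, has color -1 exactly when c
    holds; the flag mk says whether the enlarged block stays open with a mark.
     With V empty this creates the singleton of m. *)
Definition ext (mk : bool) m p V (c : bool) : epart n :=
  EPart (add_block m (blocks p) V)
        (if c then new_arcs m V :|: negarcs p else negarcs p)
        (if mk then (m |: V) |: (marked p :\ V) else marked p :\ V).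

(** The data from which a partition of D and m is built: the empty V encodes
    the letter *, which offers no color, so that c is then fixed to have a
    unique encoding. *)
Definition choice_ok eps D m p V (c : bool) : bool :=
  stage eps D p && (if eps m == Star then (V == set0) && ~~ c
                    else V \in open_blocks p).

(** V gets a mark back as soon as it has two elements: before m arrived it was
    open, whatever letter closed it or kept it. *)
Definition unext m p : epart n * {set 'I_n} * bool :=
  let B := pblock (blocks p) m in let V := B :\ m in
  (EPart (rem_block m (blocks p)) [set a in negarcs p | a.2 != m]
         (if (1 < #|V|)%N then V |: (marked p :\ B) else marked p :\ B),
   V, [exists a in negarcs p, a.2 == m]).

Lemma choice_mem eps D m p V c : choice_ok eps D m p V c -> V \in set0 |: blocks p.
Proof.
case/andP=> st; case: ifP => _; first by case/andP=> /eqP -> _; rewrite setU11.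
by move=> /(open_blocks_sub st) h; rewrite setU1r.
Qed.

Lemma is_min_setU1_top m V i : (forall i, i \in V -> (i < m)%N) -> i \in V ->
  is_min i (m |: V) = is_min i V.
Proof.
move=> hV iV; apply/is_minP/is_minP => -[_ h]; split=> //.
- by move=> j jV; apply/h/setU1r.
- exact: setU1r.
- by move=> j /setU1P [->|/h //]; apply/ltnW/hV.
Qed.

Lemma is_maxF_setU1_top m V i : (forall i, i \in V -> (i < m)%N) -> i \in V ->
  is_max i (m |: V) = false.
Proof.
move=> hV iV; apply/negP => /is_maxP [_ /(_ m (setU11 _ _))].
by rewrite leqNgt hV.
Qed.

Lemma is_minF_setU1_top m V : (forall i, i \in V -> (i < m)%N) ->
  is_min m (m |: V) = (V == set0).
Proof.
move=> hV; apply/is_minP/eqP => [[_ h]|->]; last first.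
  by rewrite setU0 set11; split=> // j /set1P ->.
apply/setP => i; rewrite inE; apply/negP => iV.
by have := h i (setU1r _ iV); rewrite leqNgt hV.
Qed.

Section Step.
Variables (eps : 'I_n -> letter) (D : {set 'I_n}) (m : 'I_n).
Hypothesis Dlt : forall i, i \in D -> (i < m)%N.

Let mD : m \notin D. Proof. by apply/negP => /Dlt; rewrite ltnn. Qed.

Lemma mem_lt p V : partition (blocks p) D -> V \in set0 |: blocks p ->
  forall i, i \in V -> (i < m)%N.
Proof.
by move=> pP /setU1P [->|VP] i; [rewrite inE|move=> iV; apply/Dlt/(partition_mem pP VP)].
Qed.

Lemma arcs_lt P a : partition P D -> a \in arcs P -> (a.2 < m)%N.
Proof. by move=> pP /arcsP [B [BP _ aB _ _]]; apply/Dlt/(partition_mem pP BP). Qed.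

(** An element of V keeps its letter when V gains m: it is the minimum, with
    letter *, or it is not, and then it carried ′ already, since an open block
    with two elements is marked. *)
Lemma ext_stage p V c : choice_ok eps D m p V c ->
  stage eps (m |: D) (ext (eps m == Prime) m p V c).
Proof.
move=> ch; have VP := choice_mem ch.
case/andP: (ch) => st hV; have /stageP [pP hN hM hL] := st.
have Vlt := mem_lt pP VP; have [mV mVP] := add_notin pP mD VP.
apply/stageP; split => /=.
- exact: partition_add.
- move=> a; rewrite (arcs_add pP Dlt VP) in_setU.
  by case: ifP => _; [rewrite in_setU => /orP [->//|]|]; move=> /hN ->; rewrite orbT.
- have hsub B : B \in marked p :\ V -> B \in add_block m (blocks p) V /\ (1 < #|B|)%N.
    by move=> /setD1P [BV /hM [BP BC]]; split=> //; apply/setU1r/setD1P.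
  case: ifP => [/eqP eP|_] B; last exact: hsub.
  move=> /setU1P [->|/hsub //]; split; first exact: setU11.
  move: hV; rewrite eP => /(open_blocks_sub st) /(partition_neq0 pP).
  by rewrite cardsU1 mV -card_gt0.
- move=> B i /setU1P [->|/setD1P [BV BP] iB].
    move=> /setU1P [->|iV]; rewrite /letter_at /=.
      rewrite is_minF_setU1_top // (is_max_setU1_top Vlt) orbF.
      move: hV; case: (eps m) => /=.
      + move=> /(open_blocks_sub st) /(partition_neq0 pP) /negPf ->.
        by case: ifP => // /setD1P [_ /hM []]; rewrite (negPf mVP).
      + by case/andP=> ->.
      + move=> /(open_blocks_sub st) /(partition_neq0 pP) /negPf ->.
        by rewrite setU11.
    rewrite is_min_setU1_top // is_maxF_setU1_top // orbT.
    case: ifP hV => [_ /andP [/eqP V0 _]|_ Vo]; first by rewrite V0 inE in iV.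
    rewrite (hL V i (open_blocks_sub st Vo) iV) /letter_at.
    case: ifP => // im; move: Vo; rewrite (open_blocksE _ st).
    case/andP => _ /orP [-> //|/cards1P [x Vx]].
    by case/negP: im; apply/is_minP; split=> // j; move: iV; rewrite Vx => /set1P -> /set1P ->.
  (* A block other than V keeps its elements and its mark. *)
  rewrite (hL B i BP iB) /letter_at /=.
  have -> // : (B \in if eps m == Prime then (m |: V) |: marked p :\ V else marked p :\ V) = (B \in marked p).
  have BmV : B != m |: V by apply: contraNneq mVP => <-.
  by case: ifP => _; rewrite !inE ?(negPf BmV) /= BV.
Qed.

Lemma extK p V c : choice_ok eps D m p V c ->
  unext m (ext (eps m == Prime) m p V c) = (p, V, c).
Proof.
move=> ch; have VP := choice_mem ch.
case/andP: (ch) => st hV; have /stageP [pP hN hM hL] := st.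
have Vlt := mem_lt pP VP; have [mV mVP] := add_notin pP mD VP.
rewrite /unext /= (pblock_add pP mD VP) (add_blockK pP mD VP) setU1K //.
have hN2 a : a \in negarcs p -> a.2 != m.
  by move=> /hN /(arcs_lt pP); apply: contraTneq => ->; rewrite ltnn.
have eM : (if eps m == Prime then (m |: V) |: marked p :\ V else marked p :\ V) :\ (m |: V)
          = marked p :\ V.
  have h : (m |: V) \notin marked p :\ V.
    by apply: contra mVP => /setD1P [_ /hM []].
  case: ifP => _; first by rewrite setU1K.
  by apply/setDidPl; rewrite disjoint_sym disjoints1.
congr (_, _, _).
- rewrite eM; case: p pP hN hM hN2 st {ch hL VP eM mVP} hV => P N M /= pP hN hM hN2 st hV.
  congr EPart.
    apply/setP => a; rewrite inE.
    case: (boolP (a \in N)) => [aN|aN].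
      by rewrite (hN2 _ aN) andbT; case: ifP; rewrite // in_setU aN orbT.
    case: ifP => _; rewrite ?in_setU (negPf aN) // orbF inE.
    by case: eqP => // _; rewrite !andbF.
  case: ifP => V1.
    apply: setD1K; move: hV; case: ifP => [_ /andP [/eqP V0 _]|_].
      by rewrite V0 cards0 in V1.
    by rewrite (open_blocksE _ st) => /andP [_ /orP [//|/eqP V1']]; rewrite V1' in V1.
  by apply/setDidPl; rewrite disjoint_sym disjoints1; apply: contraFN V1 => /hM [].
- apply/exists_inP/idP => [[a]|].
    by case: c {ch hV} => // /hN2 /negPf ->.
  move=> c1; move: hV; rewrite c1 andbF.
  case: ifP => // _ /(open_blocks_sub st) /(partition_neq0 pP) V0.
  by exists (top m V, m) => //=; rewrite in_setU new_arcsE // set11.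
Qed.

Lemma unextK p : stage eps (m |: D) p ->
  let z := unext m p in choice_ok eps D m z.1.1 z.1.2 z.2
  /\ ext (eps m == Prime) m z.1.1 z.1.2 z.2 = p.
Proof.
move=> st; have /stageP [pP' hN hM hL] := st.
rewrite /unext /=; have [pP VP eP] := partition_rem pP' mD.
have [BP mB] := partition_pblock pP'.
set B := pblock _ _ in VP eP BP mB *; set V := B :\ m in VP eP *.
set P := rem_block m (blocks p) in pP VP eP *.
have mV : m \notin V by rewrite !inE eqxx.
have BV : m |: V = B by rewrite /V setD1K.
have Vlt : forall i, i \in V -> (i < m)%N.
  by move=> i; case/setU1P: VP => [->|VP]; [rewrite inE|move=> iV; apply/Dlt/(partition_mem pP VP)].
have mVP : B \notin P by rewrite -BV; exact: (add_notin pP mD VP).2.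
have eA : arcs (blocks p) = new_arcs m V :|: arcs P by rewrite -eP (arcs_add pP Dlt VP).
have VM : V \notin marked p.
  apply: contra mV => /hM [VB _]; have /set0Pn [x xV] := partition_neq0 pP' VB.
  have xB : x \in B by rewrite -BV setU1r.
  by rewrite (partition_same pP' VB BP xV xB).
clearbody P V.
have hP B' : B' \in blocks p -> B' != B -> B' \in P /\ B' != V.
  by rewrite -eP => /setU1P [->|/setD1P [] //]; rewrite BV eqxx.
have hP' B' : B' \in P -> B' != V -> B' \in blocks p /\ B' != B.
  move=> h1 h2; rewrite -eP; split; first by apply/setU1r/setD1P.
  by apply: contraNneq mVP => <-.
(* An element of V is not the maximum of B, so its letter cannot be 1. *)
have hLB i : i \in V -> eps i = if is_min i V then Star else Prime.
  move=> iV; rewrite (hL B i) //; last by rewrite -BV setU1r.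
  by rewrite /letter_at -BV is_min_setU1_top // is_maxF_setU1_top // orbT.
have hLm : eps m = if V == set0 then Star else if B \in marked p then Prime else One.
  by rewrite (hL B m) // /letter_at -BV is_minF_setU1_top // is_max_setU1_top // orbF.
have hV1 : ~~ (1 < #|V|)%N -> V != set0 -> #|V| = 1%N.
  by rewrite -card_gt0; case: #|V| => [|[|k]].
have VP' : V != set0 -> V \in P by move=> V0; case/setU1P: VP => // e; rewrite e eqxx in V0.
set p1 := EPart _ _ _.
have st1 : stage eps D p1.
  apply/stageP; split=> //=.
  - move=> a; rewrite inE => /andP [/hN]; rewrite eA in_setU => /orP [|//].
    by rewrite inE => /andP [_ ->].
  - have h0 B' : B' \in marked p :\ B -> B' \in P /\ (1 < #|B'|)%N.
      by move=> /setD1P [h1 /hM [h2 h3]]; split=> //; apply: (hP _ h2 h1).1.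
    move=> B'; case: ifP => [V1|_ /h0 //] /setU1P [->|/h0 //]; split=> //.
    by apply: VP'; rewrite -card_gt0; apply: ltnW.
  - move=> B' i B'P iB'; have [eV|nV] := eqVneq B' V.
      subst B'; rewrite hLB // /letter_at /=; case: ifP => // im.
      case: (boolP (1 < #|V|)%N) => V1; first by rewrite setU11.
      have V0 : V != set0 by apply/set0Pn; exists i.
      have /cards1P [x Vx] : #|V| == 1%N by rewrite (hV1 _ V0) ?V1.
      by case/negP: im; apply/is_minP; split=> // j; move: iB'; rewrite Vx => /set1P -> /set1P ->.
    have [h1 h2] := hP' _ B'P nV.
    rewrite (hL _ _ h1 iB') /letter_at /=.
    by case: (1 < #|V|)%N; rewrite !inE h2 ?(negPf nV).
split.
  rewrite /choice_ok st1 /=; case: ifP; rewrite hLm.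
    case: (V == set0) / eqP => [V0 _|_]; last by case: (B \in marked p).
    apply/existsPn => a; rewrite negb_and; case: (boolP (a \in negarcs p)) => //= /hN.
    rewrite eA V0 new_arcs0 set0U => /(arcs_lt pP).
    by case: eqP => // ->; rewrite ltnn.
  case: (boolP (V == set0)) => // V0 _; rewrite (open_blocksE _ st1) /= (VP' V0) /=.
  by case: ifP => V1; rewrite ?setU11 // (hV1 _ V0) ?eqxx ?orbT ?V1.
have eMD : (if (1 < #|V|)%N then V |: marked p :\ B else marked p :\ B) :\ V = marked p :\ B.
  have h : V \notin marked p :\ B by rewrite inE negb_and VM orbT.
  case: ifP => _; first by rewrite setU1K.
  by apply/setDidPl; rewrite disjoint_sym disjoints1.
rewrite /ext /= eP eMD BV.
have -> : (if eps m == Prime then B |: marked p :\ B else marked p :\ B) = marked p.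
  rewrite hLm; case: (boolP (B \in marked p)) => [BM|BM].
    case: (boolP (V == set0)) => /= V0; last by rewrite setD1K.
    by case: (hM _ BM); rewrite -BV (eqP V0) setU0 cards1.
  by case: (V == set0) => /=; apply/setDidPl; rewrite disjoint_sym disjoints1.
have -> : (if [exists a in negarcs p, a.2 == m] then new_arcs m V :|: [set a in negarcs p | a.2 != m]
           else [set a in negarcs p | a.2 != m]) = negarcs p.
  (* At most one arc ends at m, so one bit records its color. *)
  have hnew a : a \in negarcs p -> a.2 == m -> a \in new_arcs m V.
    move=> /hN; rewrite eA in_setU => /orP [//|/(arcs_lt pP)].
    by case: eqP => // ->; rewrite ltnn.
  case: ifP => [/exists_inP [b bN bm]|/negbT h].
    have V0 : V != set0.
      by have := hnew b bN bm; case: eqP => // ->; rewrite new_arcs0 inE.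
    have := hnew b bN bm; rewrite new_arcsE // => /set1P eb.
    apply/setP => a; rewrite !inE; case: (a =P _) => [->|na] /=; first by rewrite -eb bN.
    case: (boolP (a \in negarcs p)) => //= aN; apply/negP => am.
    by have := hnew a aN am; rewrite new_arcsE // => /set1P.
  apply/setP => a; rewrite inE; case: (boolP (a \in negarcs p)) => //= aN.
  by apply/negP => am; case/negP: h; apply/exists_inP; exists a.
by case: (p).
Qed.

(** Reading off m is a bijection: the block of m, with m taken away, is V, and
    the color of the arc ending at m is c. *)
Lemma sum_stage (W : nmodType) (F : epart n -> W) :
  \sum_(p | stage eps (m |: D) p) F p
  = \sum_(z : epart n * {set 'I_n} * bool | choice_ok eps D m z.1.1 z.1.2 z.2)
      F (ext (eps m == Prime) m z.1.1 z.1.2 z.2).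
Proof.
rewrite (reindex_onto (fun z => ext (eps m == Prime) m z.1.1 z.1.2 z.2) (unext m)).
  apply: eq_bigl => -[[p V] c] /=; apply/andP/idP => [[st /eqP e]|ch].
    by have [+ _] := unextK st; rewrite e.
  by rewrite extK // eqxx ext_stage.
by move=> p /unextK [].
Qed.

End Step.
End Stages.

(** * The statistics under insertion of a point *)

Section Statistics.
Variable n : nat.
Implicit Types (i j m : 'I_n) (a b : 'I_n * 'I_n) (B V W D : {set 'I_n}).
Implicit Types (P : {set {set 'I_n}}) (p : epart n) (A N : {set 'I_n * 'I_n}).

Lemma card_setX_rel (I J : finType) (A : {set I}) (B : {set J}) (r : I -> J -> bool) :
  #|[set ab in finset.setX A B | r ab.1 ab.2]| = (\sum_(a in A) \sum_(b in B) r a b)%N.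
Proof.
rewrite -sum1_card pair_big /= big_mkcond [RHS]big_mkcond /=.
apply: eq_bigr => -[a b] _; rewrite !inE /=.
by case: (a \in A); case: (b \in B); case: (r a b).
Qed.

(** The oriented half of [crosses]: the arc that starts first comes first. *)
Definition crossing a b : bool := [&& a.1 < b.1, b.1 < a.2 & a.2 < b.2]%N.

(** An arc joins consecutive elements of its block, so no element of that
    block lies strictly between its ends.  Hence crossing or nested arcs are
    automatically in distinct blocks, and the statistics do not see the
    partition but only its arcs. *)
Lemma arc_gap P D a b : partition P D -> a \in arcs P -> b \in arcs P ->
  (a.1 < b.1 < a.2)%N -> distinct_blocks P a b.
Proof.
move=> pP /arcsP [B [BP a1 a2 _ h]] /arcsP [B' [BP' b1 b2 _ _]] /andP [h1 h2].
have /and3P [_ tr _] := pP.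
rewrite /distinct_blocks (def_pblock tr BP a1) (def_pblock tr BP' b1).
by apply: contraTneq h2 => e; rewrite -leqNgt h // e.
Qed.

(** Of the two orders on a pair of crossing arcs exactly one is [crossing], so
    unordered pairs are counted by that order. *)
Lemma rcE p D : partition (blocks p) D ->
  rc p = (\sum_(a in arcs (blocks p)) \sum_(b in arcs (blocks p)) crossing a b)%N.
Proof.
move=> pP; rewrite -card_setX_rel /rc; set A := arcs _.
set f := fun ab : ('I_n * 'I_n) * ('I_n * 'I_n) => [set ab.1; ab.2].
have fC a b : f (a, b) = f (b, a) by rewrite /f finset.setUC.
rewrite -(@card_in_imset _ _ f); last first.
  move=> [a b] [a' b']; rewrite !inE /= /crossing.
  move=> /andP [_ /and3P [h1 _ _]] /andP [_ /and3P [h2 _ _]] e.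
  have : a \in f (a', b') by rewrite -e !inE eqxx.
  have : b \in f (a', b') by rewrite -e !inE eqxx orbT.
  rewrite !inE /= => /orP [] /eqP eb /orP [] /eqP ea; rewrite ?ea ?eb // in h1 *.
  - by rewrite ltnn in h1.
  - by have := ltn_trans h1 h2; rewrite ltnn.
  - by rewrite ltnn in h1.
congr #|pred_of_set _|; apply/setP => s; apply/imsetP/imsetP => -[[a b]].
  rewrite inE in_setX /= => /andP [/andP [aA bA] /andP [_ /orP [h|h]]] ->.
    by exists (a, b) => //; rewrite inE in_setX /= aA bA.
  by exists (b, a) => //; rewrite ?fC // inE in_setX /= aA bA.
rewrite inE in_setX /= => /andP [/andP [aA bA] h] ->; exists (a, b) => //.
rewrite inE in_setX /= aA bA /crosses -/(crossing a b) h /= andbT.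
by case/and3P: h => h1 h2 _; apply: (arc_gap pP); rewrite ?h1.
Qed.

Lemma rnarcE p D : partition (blocks p) D -> negarcs p \subset arcs (blocks p) ->
  rnarc p = (\sum_(a in arcs (blocks p)) \sum_(b in negarcs p) nests a b)%N.
Proof.
move=> pP /subsetP hN; rewrite -card_setX_rel /rnarc; congr #|pred_of_set _|.
apply/setP => -[a b]; rewrite inE in_setX [RHS]inE in_setX /=.
case: (boolP (a \in _)) => //= aA; case: (boolP (b \in _)) => //= bN.
case: (boolP (nests a b)) => [/and3P [h1 h2 h3]|]; last by rewrite andbF.
by rewrite andbT; apply: (arc_gap pP aA (hN _ bN)); rewrite h1 (ltn_trans h2).
Qed.

Definition inside V a : bool := (a.1 < bmax V)%N && (bmax V < a.2)%N.
Definition before V a : bool := (bmax V < a.1)%N && (bmax V < a.2)%N.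

Lemma MaxCE p : MaxC p = (\sum_(V in open_blocks p) \sum_(a in arcs (blocks p)) inside V a)%N.
Proof. exact: card_setX_rel. Qed.

Lemma MaxLE p : MaxL p = (\sum_(V in open_blocks p) \sum_(a in negarcs p) before V a)%N.
Proof. exact: card_setX_rel. Qed.

(** The number of open blocks whose tensor factor stands to the right of that
    of V. *)
Definition above p V : nat := #|[set W in open_blocks p | (bmax V < bmax W)%N]|.
Definition below p V : nat := #|[set W in open_blocks p | (bmax W < bmax V)%N]|.

(** V itself never counts, so it may be dropped from the sum; this is the set
    over which [sum_open_ext] sums. *)
Lemma card_open_rel (r : rel nat) p V : irreflexive r ->
  #|[set W in open_blocks p | r (bmax V) (bmax W)]|
  = (\sum_(W in open_blocks p :\ V) r (bmax V) (bmax W))%N.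
Proof.
move=> ir; rewrite -sum1_card big_mkcond [RHS]big_mkcond /=.
apply: eq_bigr => W _; rewrite !inE; case: (W =P V) => [->|_] /=; first by rewrite ir andbF.
by case: (_ || _); case: (r _ _).
Qed.

Section Step.
Variables (eps : 'I_n -> letter) (D : {set 'I_n}) (m : 'I_n).
Hypothesis Dlt : forall i, i \in D -> (i < m)%N.
Variables (p : epart n) (V : {set 'I_n}) (c : bool).
Hypothesis ch : choice_ok eps D m p V c.

Let mk := eps m == Prime.
Let p' := ext mk m p V c.
Let mD : m \notin D. Proof. by apply/negP => /Dlt; rewrite ltnn. Qed.
Let st : stage eps D p. Proof. by case/andP: ch. Qed.
Let pP : partition (blocks p) D. Proof. by case/stageP: st. Qed.
Let VP : V \in set0 |: blocks p. Proof. exact: choice_mem ch. Qed.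
Let Vlt : forall i, i \in V -> (i < m)%N. Proof. by move=> i; apply: (mem_lt Dlt pP VP). Qed.
Let mV : m \notin V. Proof. exact: (add_notin pP mD VP).1. Qed.
Let mVP : (m |: V) \notin blocks p. Proof. exact: (add_notin pP mD VP).2. Qed.

Lemma choice_star : (eps m == Star) = (V == set0).
Proof.
case/andP: ch => _; case: ifP => [_ /andP [-> //]|_ /(open_blocks_sub st)].
by move=> /(partition_neq0 pP) /negPf ->.
Qed.

Lemma choice_open : V != set0 -> V \in open_blocks p.
Proof. by move=> V0; case/andP: ch => _; rewrite choice_star (negPf V0). Qed.

Lemma open_block_neq0 W : W \in open_blocks p -> W != set0.
Proof. by move=> /(open_blocks_sub st) /(partition_neq0 pP). Qed.

Lemma open_block_lt W : W \in open_blocks p -> (bmax W < m)%N.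
Proof.
move=> Wo; have WP := open_blocks_sub st Wo.
rewrite (bmax_top m (partition_neq0 pP WP)); apply: Dlt.
by apply: (partition_mem pP WP); have /is_maxP [] := top_max m (partition_neq0 pP WP).
Qed.

(** The new block is open if it is a singleton or keeps its mark; V, absorbed,
    no longer counts. *)
Lemma open_blocks_ext : open_blocks p' =
  if mk || (V == set0) then (m |: V) |: (open_blocks p :\ V) else open_blocks p :\ V.
Proof.
have st' : stage eps (m |: D) p' by exact: ext_stage.
have oC : (#|m |: V| == 1%N) = (V == set0) by rewrite cardsU1 mV -cards_eq0.
have mkV : mk -> V != set0 by rewrite -choice_star /mk => /eqP ->.
have mVo : (m |: V) \notin open_blocks p by apply: contra mVP; exact: open_blocks_sub st.
apply/setP => W; rewrite (open_blocksE _ st').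
have [->|WV] := eqVneq W (m |: V).
  rewrite /= setU11 /= oC; case: (boolP mk) => _ /=; first by rewrite !setU11.
  case: (V == set0); first by rewrite orbT setU11.
  rewrite orbF !in_setD1 (negPf mVo) andbF.
  by apply: contraNF mVP => /andP [_]; case/stageP: st => _ _ hM _ /hM [].
transitivity ((W != V) && (W \in open_blocks p)).
  rewrite (open_blocksE _ st) /= in_setU1 (negPf WV) /= in_setD1.
  by case: mk; rewrite ?in_setU1 ?(negPf WV) ?in_setD1; case: (W == V).
by case: ifP => _; rewrite ?in_setU1 ?(negPf WV) in_setD1.
Qed.

Lemma unmarked_ext : unmarked p' =
  if mk || (V == set0) then unmarked p else (m |: V) |: unmarked p.
Proof.
have /stageP [_ _ hM _] := st.
have mVM : (m |: V) \notin marked p by apply: contra mVP => /hM [].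
have oC : (1 < #|m |: V|)%N = (V != set0) by rewrite cardsU1 mV ltnS card_gt0.
have VU : V \notin unmarked p.
  have [V0|V0] := eqVneq V set0; first by rewrite !inE V0 cards0 !andbF.
  have := choice_open V0; rewrite (open_blocksE _ st) => /andP [_ /orP [h|/eqP h]].
    by rewrite !inE h.
  by rewrite !inE h !andbF.
apply/setP => W; rewrite [LHS]in_setD [_ \in nonsingletons _]inE /=.
have [->|WV] := eqVneq W (m |: V).
  rewrite setU11 oC; case: (boolP (mk || (V == set0))) => [h|/norP [/negPf h V0]].
    have -> : (m |: V) \in unmarked p = false by rewrite !inE (negPf mVP) !andbF.
    by case/orP: h => [->|->]; rewrite ?setU11 ?andbF.
  by rewrite setU11 h !inE (negPf mVM) V0 !andbF.
have -> : (W \in if mk || (V == set0) then unmarked p else (m |: V) |: unmarked p) = (W \in unmarked p).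
  by case: ifP => _; rewrite ?in_setU1 ?(negPf WV).
have [->|WnV] := eqVneq W V.
  rewrite (negPf VU) in_setU1 eq_sym !in_setD1 eqxx /=.
  by have [e|_] := eqVneq V (m |: V); [have := mV; rewrite e setU11|rewrite !andbF].
have -> : (W \in if mk then (m |: V) |: marked p :\ V else marked p :\ V) = (W \in marked p).
  by case: ifP => _; rewrite ?in_setU1 ?(negPf WV) in_setD1 WnV.
by rewrite in_setU1 (negPf WV) in_setD1 WnV in_setD inE.
Qed.

(** The new block contributes 0 to MaxC and MaxL even when it is open: its
    maximum is m, and no arc ends after m. *)
Lemma sum_open_ext (G : {set 'I_n} -> nat) : G (m |: V) = 0%N ->
  (\sum_(W in open_blocks p') G W = \sum_(W in open_blocks p :\ V) G W)%N.
Proof.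
move=> G0; rewrite open_blocks_ext; case: ifP => // _.
rewrite big_setU1 ?G0 //=; apply: contra mVP => /setD1P [_]; exact: open_blocks_sub st.
Qed.

Lemma bmax_new : bmax (m |: V) = m. Proof. exact: bmax_setU1_top. Qed.

Lemma arc_ltm a : a \in arcs (blocks p) -> (a.2 < m)%N.
Proof. exact: (arcs_lt Dlt pP). Qed.

Lemma neg_arc a : a \in negarcs p -> a \in arcs (blocks p).
Proof. by case/stageP: st => _ hN _ _; apply: hN. Qed.

Lemma arc_lt a : a \in arcs (blocks p) -> (a.1 < a.2)%N.
Proof. by case/arcsP => B []. Qed.

Let st' : stage eps (m |: D) p'. Proof. exact: ext_stage. Qed.
Let pP' : partition (blocks p') (m |: D). Proof. by case/stageP: st'. Qed.
Let hN' : negarcs p' \subset arcs (blocks p').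
Proof. by apply/subsetP; case/stageP: st'. Qed.
Let hN : negarcs p \subset arcs (blocks p).
Proof. by apply/subsetP; case/stageP: st. Qed.

Lemma arcs_ext : arcs (blocks p') = new_arcs m V :|: arcs (blocks p).
Proof. exact: arcs_add pP Dlt VP. Qed.

(** A singleton at the right end creates no arc and is neither under an arc
    nor to the left of one. *)
Lemma stats_star : V = set0 ->
  [/\ rc p' = rc p, MaxC p' = MaxC p, rnarc p' = rnarc p & MaxL p' = MaxL p]
  /\ Narc p' = Narc p.
Proof.
move=> V0; have c0 : c = false.
  by case/andP: ch => _; rewrite choice_star V0 eqxx => /=; case: c.
have eA : arcs (blocks p') = arcs (blocks p) by rewrite arcs_ext V0 new_arcs0 set0U.
have eN : negarcs p' = negarcs p by rewrite /p' /= c0.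
have oV : open_blocks p :\ V = open_blocks p.
  apply/setDidPl; rewrite disjoint_sym disjoints1 V0.
  by apply/negP => /open_block_neq0; rewrite eqxx.
split; last by rewrite /Narc eN.
split; first by rewrite (rcE pP) (rcE pP') eA.
- rewrite !MaxCE sum_open_ext ?oV ?eA // big1 // => a /arc_ltm h.
  by rewrite /inside bmax_new (ltnNge m) (ltnW h) andbF.
- by rewrite (rnarcE pP) // (rnarcE pP') // eA eN.
- rewrite !MaxLE sum_open_ext ?oV ?eN // big1 // => a /neg_arc /arc_ltm h.
  by rewrite /before bmax_new (ltnNge m a.2) (ltnW h) andbF.
Qed.

Section Arc.
Hypothesis V0 : V != set0.
Let t := top m V.
Let e := (t, m).
Let bV : bmax V = t. Proof. exact: bmax_top. Qed.
Let Vo := choice_open V0.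

Let eA : arcs (blocks p') = e |: arcs (blocks p).
Proof. by rewrite arcs_ext new_arcsE. Qed.
Let enA : e \notin arcs (blocks p).
Proof. by apply/negP => /arc_ltm; rewrite ltnn. Qed.
Let enN : e \notin negarcs p.
Proof. by apply: contra enA; exact: neg_arc. Qed.
Let eN : negarcs p' = if c then e |: negarcs p else negarcs p.
Proof. by rewrite /p' /= new_arcsE. Qed.

Lemma Narc_ext : Narc p' = (Narc p + c)%N.
Proof. by rewrite /Narc eN; case: c; rewrite ?addn0 // cardsU1 enN addnC. Qed.

Lemma sum_negarcs (G : 'I_n * 'I_n -> nat) :
  (\sum_(a in negarcs p') G a = c * G e + \sum_(a in negarcs p) G a)%N.
Proof. by rewrite eN; case: c; rewrite ?mul1n ?mul0n //= big_setU1. Qed.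

Let arc_lem a : a \in arcs (blocks p') -> (a.2 <= m)%N.
Proof.
move=> /arcsP [B [BP _ aB _ _]].
by have /setU1P [->|/Dlt /ltnW] := partition_mem pP' BP aB.
Qed.

(** The arcs around max V were counted for V in MaxC and now cross the new
    arc; the new arc passes over the open blocks with larger maximum.  Only
    the sum of the two statistics obeys a simple rule. *)
Lemma rc_MaxC_ext : (rc p' + MaxC p' = rc p + MaxC p + above p V)%N.
Proof.
rewrite (rcE pP) (rcE pP') !MaxCE sum_open_ext; last first.
  rewrite big1 // => a /arc_lem h.
  by rewrite /inside bmax_new (ltnNge m) h andbF.
rewrite eA big_setU1 //= big_setU1 //= [crossing e e]/crossing ltnn /= add0n.
(* No arc starts before m and ends after it, so the new arc is never the left
   one of a crossing pair. *)
have -> : (\sum_(b in arcs (blocks p)) crossing e b = 0)%N.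
  rewrite big1 // => b /arc_ltm h.
  by rewrite /crossing /= (ltnNge m) (ltnW h) !andbF.
rewrite add0n.
under eq_bigr => a aA.
  rewrite big_setU1 //=.
  have -> : crossing a e = inside V a :> nat.
    by rewrite /crossing /inside bV /= (arc_ltm aA) andbT.
  over.
under [X in (_ + X)%N]eq_bigr => W /setD1P [_ Wo].
  rewrite big_setU1 //= [inside W e]/inside /= (open_block_lt Wo) andbT.
  over.
rewrite !big_split /= [X in (_ = _ + X + _)%N](big_setD1 V) //=.
have -> : above p V = (\sum_(W in open_blocks p :\ V) (bmax V < bmax W))%N.
  by apply: (@card_open_rel ltn) => x; apply: ltnn.
by rewrite bV; ring.
Qed.

(** The negative arcs to the right of max V were counted for V in MaxL and are
    now nested by the new arc, which is itself nested by none; if it is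
    negative, it lies to the right of the open blocks with smaller maximum. *)
Lemma rnarc_MaxL_ext : (rnarc p' + MaxL p' = rnarc p + MaxL p + c * below p V)%N.
Proof.
rewrite (rnarcE pP) // (rnarcE pP') // !MaxLE sum_open_ext; last first.
  rewrite big1 // => a /(subsetP hN') /arc_lem h.
  by rewrite /before bmax_new (ltnNge m a.2) h andbF.
rewrite eA big_setU1 //= sum_negarcs [nests e e]/nests ltnn /= muln0 add0n.
(* As t < b.1 implies t < b.2 and b.2 < m, both sides count the negative arcs
   that start after t. *)
have -> : (\sum_(b in negarcs p) nests e b = \sum_(b in negarcs p) before V b)%N.
  apply: eq_bigr => b /neg_arc bA.
  rewrite /nests /before bV /= (arc_ltm bA) (arc_lt bA) /=.
  by case: ltnP => // h; rewrite (ltn_trans h (arc_lt bA)).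
under [X in (_ + X + _)%N]eq_bigr => a aA.
  rewrite sum_negarcs.
  have -> : nests a e = false by rewrite /nests /= (ltnNge m) (ltnW (arc_ltm aA)) !andbF.
  rewrite muln0 add0n; over.
under [X in (_ + X)%N]eq_bigr => W /setD1P [_ Wo].
  rewrite sum_negarcs [before W e]/before /= (open_block_lt Wo) andbT.
  over.
rewrite !big_split /= [X in (_ = _ + X + _)%N](big_setD1 V) //= -big_distrr /=.
have -> : below p V = (\sum_(W in open_blocks p :\ V) (bmax W < bmax V))%N.
  by apply: (@card_open_rel gtn) => x; apply: ltnn.
by rewrite bV; ring.
Qed.

End Arc.
End Step.
End Statistics.

(** * The order of the tensor factors and the weights of the blocks *)

Section OpenOrder.
Variable n : nat.
Implicit Types (m : 'I_n) (V W D : {set 'I_n}) (p : epart n) (S : seq {set 'I_n}).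

Definition open_order p : seq {set 'I_n} :=
  sort (fun A B => (bmax A <= bmax B)%N) (enum (open_blocks p)).

Lemma mem_open_order p : open_order p =i open_blocks p.
Proof. by move=> W; rewrite mem_sort mem_enum. Qed.

Lemma open_order_uniq p : uniq (open_order p).
Proof. by rewrite sort_uniq enum_uniq. Qed.

Definition bmax_lt : rel {set 'I_n} := fun V W => (bmax V < bmax W)%N.

Lemma bmax_lt_trans : transitive bmax_lt.
Proof. by move=> x y z; apply: ltn_trans. Qed.

(** Distinct blocks are disjoint, so their maxima differ and the order is
    strict. *)
Lemma open_order_sorted eps D p : stage eps D p -> sorted bmax_lt (open_order p).
Proof.
move=> st; have /stageP [pP _ _ _] := st.
have -> : sorted bmax_lt (open_order p) = sorted ltn (map (@bmax n) (open_order p)).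
  by rewrite sorted_map.
rewrite ltn_sorted_uniq_leq; apply/andP; split.
  rewrite map_inj_in_uniq ?open_order_uniq // => V W.
  rewrite !mem_open_order => /(open_blocks_sub st) VP /(open_blocks_sub st) WP.
  have /set0Pn [i iV] := partition_neq0 pP VP.
  have /is_maxP [tV _] := top_max i (partition_neq0 pP VP).
  have /is_maxP [tW _] := top_max i (partition_neq0 pP WP).
  rewrite (bmax_top i (partition_neq0 pP VP)) (bmax_top i (partition_neq0 pP WP)).
  by move=> /val_inj e; apply: (partition_same pP VP WP tV); rewrite e.
by rewrite sorted_map; apply: sort_sorted => V W; apply: leq_total.
Qed.

(** A strictly sorted sequence is determined by its members; this identifies
    the order of the factors after each letter. *)
Lemma open_order_eq eps D p S : stage eps D p -> sorted bmax_lt S ->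
  S =i open_blocks p -> S = open_order p.
Proof.
move=> st hS e; apply: (irr_sorted_eq bmax_lt_trans) => //.
- by move=> V; apply: ltnn.
- exact: open_order_sorted st.
- by move=> V; rewrite e mem_open_order.
Qed.

(** The new maximum exceeds all others, so an enlarged block that stays open
    moves to the right end and no other factor moves. *)
Lemma open_order_ext eps D m p V c : (forall i, i \in D -> (i < m)%N) ->
  choice_ok eps D m p V c ->
  open_order (ext (eps m == Prime) m p V c) =
  if (eps m == Prime) || (V == set0) then rcons (rem V (open_order p)) (m |: V)
  else rem V (open_order p).
Proof.
move=> Dlt ch; have st : stage eps D p by case/andP: ch.
have sS : sorted bmax_lt (rem V (open_order p)).
  apply: (subseq_sorted bmax_lt_trans (rem_subseq _ _)); exact: open_order_sorted st.
have mS W : (W \in rem V (open_order p)) = (W \in open_blocks p :\ V).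
  by rewrite mem_rem_uniq ?open_order_uniq // inE mem_open_order in_setD1.
apply/esym/(open_order_eq (ext_stage Dlt ch)).
  case: ifP => // _; rewrite (sorted_pairwise bmax_lt_trans) pairwise_rcons.
  rewrite -(sorted_pairwise bmax_lt_trans) sS andbT; apply/allP => W.
  by rewrite mS => /setD1P [_ Wo]; rewrite /bmax_lt (bmax_new Dlt ch) (open_block_lt Dlt ch).
move=> W; rewrite (open_blocks_ext Dlt ch); case: ifP => _; last exact: mS.
by rewrite mem_rcons in_cons mS in_setU1.
Qed.

Lemma card_open (r : pred {set 'I_n}) p :
  #|[set W in open_blocks p | r W]| = count r (open_order p).
Proof.
rewrite -sum1_card -sum1_count [RHS](perm_big (enum (open_blocks p))) /=; last first.
  by rewrite perm_sort.
by rewrite big_enum_cond; apply: eq_bigl => W; rewrite !inE.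
Qed.

(** Translates positions in the word, which appear in the exponents of the
    operators, into the counts that govern the statistics. *)
Lemma index_open_order eps D p V : stage eps D p -> V \in open_blocks p ->
  index V (open_order p) = below p V
  /\ size (open_order p) = (below p V + (above p V).+1)%N.
Proof.
move=> st; rewrite -mem_open_order => Vo.
have := open_order_sorted st; rewrite (sorted_pairwise bmax_lt_trans).
rewrite /below /above !card_open; move: Vo.
set S := open_order p => Vo; have kS : (index V S < size S)%N by rewrite index_mem.
have eS : S = take (index V S) S ++ V :: drop (index V S).+1 S.
  by rewrite -{1}(cat_take_drop (index V S) S) (drop_nth set0) // nth_index.
set k := index V S in kS eS *.
rewrite eS pairwise_cat pairwise_cons => /and3P [/allrelP h1 _ /andP [/allP h2 _]].
(* Everything left of V in S counts for [below], everything right of V for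
   [above]. *)
have cE (r : pred {set 'I_n}) (s : seq {set 'I_n}) b :
    {in s, forall W, r W = b} -> count r s = if b then size s else 0%N.
  case: b => h; first by apply/eqP; rewrite -all_count; apply/allP => W /h.
  by rewrite -(@eq_in_count _ pred0) ?count_pred0 // => W /h ->.
rewrite !count_cat /= !ltnn !add0n.
rewrite (cE _ (take k S) true); last first.
  by move=> W Wt /=; apply: h1 => //; rewrite mem_head.
rewrite (cE _ (take k S) false); last first.
  move=> W Wt /=; apply/negbTE; rewrite -leqNgt ltnW //.
  by apply: h1 => //; rewrite mem_head.
rewrite (cE _ (drop k.+1 S) false); last first.
  by move=> W Wt /=; apply/negbTE; rewrite -leqNgt ltnW //; apply: h2.
rewrite (cE _ (drop k.+1 S) true); last by move=> W Wt /=; apply: h2.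
rewrite size_cat /= size_takel ?(ltnW kS) // addn0 add0n; split=> //.
Qed.

Lemma sum_open_order (M : nmodType) p (G : nat -> {set 'I_n} -> M) :
  \sum_(k < size (open_order p)) G k (nth set0 (open_order p) k)
  = \sum_(V in open_blocks p) G (index V (open_order p)) V.
Proof.
transitivity (\sum_(V <- open_order p) G (index V (open_order p)) V).
  rewrite (big_nth set0) big_mkord; apply: eq_bigr => k _.
  by rewrite index_uniq ?open_order_uniq.
by rewrite (perm_big (enum (open_blocks p))) ?big_enum //= perm_sort.
Qed.

End OpenOrder.

Section BlockWeights.
Variables (R : realType) (HR : completeNormedModType R).
Local Notation H := (complexification HR).
Variables (ip : {dot HR for idfun}) (bar : {linear H -> H}).
Variables (T : HR -> {linear H -> H}) (n : nat) (x : 'I_n -> HR).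
Implicit Types (i j m : 'I_n) (V W D : {set 'I_n}) (p : epart n) (s : seq 'I_n).

Lemma marked_op_eq p p' i s h :
  {in i :: s &, forall j k, ((j, k) \in negarcs p') = ((j, k) \in negarcs p)} ->
  marked_op bar T x p' i s h = marked_op bar T x p i s h.
Proof.
elim: s i h => //= j s IH i h e; rewrite IH; last first.
  by move=> k l ks ls; apply: e; rewrite in_cons ?ks ?ls orbT.
by rewrite /flip e ?mem_head // in_cons mem_head orbT.
Qed.

Lemma unmarked_op_eq p p' i s h :
  {in i :: s &, forall j k, ((j, k) \in negarcs p') = ((j, k) \in negarcs p)} ->
  unmarked_op bar T x p' i s h = unmarked_op bar T x p i s h.
Proof.
elim: s i h => // j s IH i h e.
have e1 g : flip bar p' (i, j) g = flip bar p (i, j) g.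
  by rewrite /flip e ?mem_head // in_cons mem_head orbT.
case: s IH e => [|k s] IH e; first by rewrite /= e1.
rewrite [LHS]/(unmarked_op bar T x p' j (k :: s) _) e1 [RHS]/(unmarked_op bar T x p j (k :: s) _).
by apply: IH => l1 l2 h1 h2; apply: e; rewrite in_cons ?h1 ?h2 orbT.
Qed.

(** The operators of marked and unmarked blocks differ only at the last arc. 
    This is why the vector of an open block can serve as the state of a block
    that will be closed later. *)
Lemma marked_op_rcons p i s m h : marked_op bar T x p i (rcons s m) h
  = T (x m) (flip bar p (last i s, m) (marked_op bar T x p i s h)).
Proof. by elim: s i h => //= j s IH i h. Qed.

Lemma unmarked_op_rcons p i s m h : unmarked_op bar T x p i (rcons s m) h
  = flip bar p (last i s, m) (marked_op bar T x p i s h).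
Proof. by elim: s i h => //= j s IH i h; rewrite -IH; case: s {IH}. Qed.

Definition recolor (c : bool) (h : H) : H := if c then bar h else h.

Section Step.
Variables (eps : 'I_n -> letter) (D : {set 'I_n}) (m : 'I_n).
Hypothesis Dlt : forall i, i \in D -> (i < m)%N.
Variables (p : epart n) (V : {set 'I_n}) (c : bool).
Hypothesis ch : choice_ok eps D m p V c.

Let mk := eps m == Prime.
Let p' := ext mk m p V c.
Let st : stage eps D p. Proof. by case/andP: ch. Qed.
Let pP : partition (blocks p) D. Proof. by case/stageP: st. Qed.
Let mD : m \notin D. Proof. by apply/negP => /Dlt; rewrite ltnn. Qed.
Let VP : V \in set0 |: blocks p. Proof. exact: choice_mem ch. Qed.
Let Vlt : forall i, i \in V -> (i < m)%N.
Proof. by move=> i; apply: (mem_lt Dlt pP VP). Qed.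

(** The only arc whose color is new ends at m, so the operators of the blocks
    without m do not change. *)
Lemma negarcs_ext i j : j != m ->
  ((i, j) \in negarcs p') = ((i, j) \in negarcs p).
Proof.
by move=> jm; rewrite /p' /=; case: ifP => // _; rewrite in_setU inE (negPf jm) andbF.
Qed.

Lemma negarcs_new : V != set0 -> ((top m V, m) \in negarcs p') = c.
Proof.
move=> V0; have h : (top m V, m) \notin negarcs p.
  by apply/negP => /(neg_arc ch) /(arc_ltm Dlt ch); rewrite ltnn.
by rewrite /p' /=; case: (c); rewrite ?in_setU ?new_arcsE ?set11 // (negPf h).
Qed.

Lemma enum_block W i s : W \in set0 |: blocks p -> enum W = i :: s ->
  {in i :: s &, forall j k, ((j, k) \in negarcs p') = ((j, k) \in negarcs p)}.
Proof.
move=> WP <- j k; rewrite !mem_enum => _ kW; apply: negarcs_ext.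
by apply: contraTneq (mem_lt Dlt pP WP kW) => ->; rewrite ltnn.
Qed.

Lemma open_vector_old W : W \in blocks p ->
  open_vector bar T x p' W = open_vector bar T x p W.
Proof.
move=> WP; rewrite /open_vector; case E: (enum W) => [//|i s].
by apply: marked_op_eq; apply: enum_block E; rewrite setU1r.
Qed.

Lemma unmarked_weight_old W : W \in blocks p ->
  unmarked_weight ip bar T x p' W = unmarked_weight ip bar T x p W.
Proof.
move=> WP; rewrite /unmarked_weight; case E: (enum W) => [//|i s].
by rewrite (unmarked_op_eq _ (enum_block (setU1r _ WP) E)).
Qed.

Lemma open_vector_new : open_vector bar T x p' (m |: V) =
  if V == set0 then embed (x m)
  else T (x m) (recolor c (open_vector bar T x p V)).
Proof.
rewrite /open_vector (enum_setU1_top Vlt).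
case: eqP => [->|/eqP V0]; first by rewrite enum_set0.
have := negarcs_new V0; rewrite /top.
case E: (enum V) => [|i s]; first by rewrite -cards_eq0 cardE E in V0.
rewrite /= marked_op_rcons /flip => ->; rewrite /recolor.
by rewrite (marked_op_eq _ (enum_block VP E)).
Qed.

(** Closing V replaces its tensor factor by the inner product of that factor,
    recolored, with the vector of the closing letter. *)
Lemma unmarked_weight_new : V != set0 -> unmarked_weight ip bar T x p' (m |: V) =
  cip ip (embed (x m)) (recolor c (open_vector bar T x p V)).
Proof.
move=> V0; rewrite /unmarked_weight /open_vector (enum_setU1_top Vlt).
have := negarcs_new V0; rewrite /top.
case E: (enum V) => [|i s]; first by rewrite -cards_eq0 cardE E in V0.
rewrite rcons_cons last_rcons unmarked_op_rcons /flip /= => ->; rewrite /recolor.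
by rewrite (marked_op_eq _ (enum_block VP E)).
Qed.

Lemma scalar_weight_ext : scalar_weight ip bar T x p' =
  (if mk || (V == set0) then 1
   else cip ip (embed (x m)) (recolor c (open_vector bar T x p V)))
  * scalar_weight ip bar T x p.
Proof.
have hU W : W \in unmarked p -> W \in blocks p by rewrite !inE => /andP [_ /andP []].
have old : \prod_(W in unmarked p) unmarked_weight ip bar T x p' W = scalar_weight ip bar T x p.
  by apply: eq_bigr => W /hU /unmarked_weight_old.
rewrite /scalar_weight (unmarked_ext Dlt ch); case: ifP => [_|/negbT /norP [_ V0]].
  by rewrite old mul1r.
rewrite big_setU1 /= ?old ?unmarked_weight_new //.
by apply: contra (add_notin pP mD VP).2; exact: hU.
Qed.

Lemma map_open_vector_old :
  [seq open_vector bar T x p' W | W <- rem V (open_order p)]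
  = [seq open_vector bar T x p W | W <- rem V (open_order p)].
Proof.
apply/eq_in_map => W /mem_rem; rewrite mem_open_order => /(open_blocks_sub st).
exact: open_vector_old.
Qed.

Lemma tensor_weight_ext : tensor_weight bar T x p' =
  let w := [seq open_vector bar T x p W | W <- rem V (open_order p)] in
  tens (if mk || (V == set0) then rcons w
         (if V == set0 then embed (x m) else T (x m) (recolor c (open_vector bar T x p V)))
        else w).
Proof.
rewrite /tensor_weight -/(open_order p') (open_order_ext Dlt ch) -/mk.
by case: ifP => _ /=; rewrite ?map_rcons map_open_vector_old ?open_vector_new.
Qed.

End Step.
End BlockWeights.

(** * The action of one letter *)

Lemma linear_sumZ (K : comNzRingType) (U W : lmodType K) (f : U -> W) (I : finType)
    (P : pred I) (a : I -> K) (t : I -> U) : linear f ->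
  f (\sum_(i | P i) a i *: t i) = \sum_(i | P i) a i *: f (t i).
Proof.
move=> lf; have f0 : f 0 = 0.
  by have := lf (-1) 0 0; rewrite scaler0 addr0 scaleN1r addNr.
apply: (big_ind2 (fun u w => f u = w)) => [//|u _ v _ <- <-|i _].
  by have := lf 1 u v; rewrite !scale1r.
by have := lf (a i) (t i) 0; rewrite f0 !addr0.
Qed.

(** Unfolds the encoding by triples: a single choice for the letter *, an open
    block and a color for the others. *)
Lemma sum_choice (n : nat) (eps : 'I_n -> letter) (D : {set 'I_n}) (m : 'I_n) (M : nmodType)
    (G : epart n -> {set 'I_n} -> bool -> M) :
  \sum_(z : epart n * {set 'I_n} * bool | choice_ok eps D m z.1.1 z.1.2 z.2)
     G z.1.1 z.1.2 z.2
  = \sum_(p | stage eps D p)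
      (if eps m == Star then G p set0 false
       else \sum_(V in open_blocks p) \sum_(c : bool) G p V c).
Proof.
rewrite big_mkcond -(pair_bigA _ (fun (pV : epart n * {set 'I_n}) c =>
  if choice_ok eps D m pV.1 pV.2 c then G pV.1 pV.2 c else 0)) /=.
rewrite -(pair_bigA _ (fun p V => \sum_(c : bool)
  if choice_ok eps D m p V c then G p V c else 0)) /=.
rewrite [RHS]big_mkcond; apply: eq_bigr => p _; rewrite /choice_ok.
(* The sums now run over all V and c; inadmissible triples contribute 0. *)
case: (stage eps D p) => /=; last by rewrite big1 // => V _; rewrite big1.
case: ifP => _.
  rewrite (bigD1 set0) //= big_bool /= eqxx /= add0r big1 ?addr0 // => V /negPf V0.
  by rewrite big1 // => c _; rewrite V0.
by rewrite [RHS]big_mkcond; apply: eq_bigr => V _; case: ifP => // _; rewrite big1.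
Qed.

Section Step.
Variables (R : realType) (HR : completeNormedModType R).
Local Notation H := (complexification HR).
Variables (ip : {dot HR for idfun}) (bar : {linear H -> H}).
Variables (T : HR -> {linear H -> H}) (alpha q : R) (n : nat).
Variables (x : 'I_n -> HR) (eps : 'I_n -> letter).
Implicit Types (m : 'I_n) (V W D : {set 'I_n}) (p : epart n).

Definition coef p : R[i] :=
  (alpha ^+ Narc p * q ^+ (rc p + MaxC p + 2 * rnarc p + 2 * MaxL p))%:C
  * scalar_weight ip bar T x p.

Definition term p : fock H := coef p *: tensor_weight bar T x p.

Let word p := [seq open_vector bar T x p W | W <- open_order p].
Let subword p V := [seq open_vector bar T x p W | W <- rem V (open_order p)].

(** Sums over the positions of the word become sums over open blocks; G
    receives the number of letters to the right and to the left, the letter,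
    and the word without it. *)
Lemma word_sum (D : {set 'I_n}) p (M : nmodType) (G : nat -> nat -> H -> seq H -> M) :
  stage eps D p ->
  \sum_(k < size (word p)) G (size (word p) - k.+1)%N k (word p)`_k (del k (word p))
  = \sum_(V in open_blocks p)
      G (above p V) (below p V) (open_vector bar T x p V) (subword p V).
Proof.
move=> st; rewrite size_map.
transitivity (\sum_(k < size (open_order p))
  G (size (open_order p) - k.+1)%N k
    (open_vector bar T x p (nth set0 (open_order p) k))
    [seq open_vector bar T x p W | W <- del k (open_order p)]).
  by apply: eq_bigr => k _; rewrite (nth_map set0) // /del map_cat map_take map_drop.
rewrite (sum_open_order p (fun k V => G (size (open_order p) - k.+1)%N k
  (open_vector bar T x p V) [seq open_vector bar T x p W | W <- del k (open_order p)])).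
apply: eq_bigr => V Vo; have [e1 e2] := index_open_order st Vo.
rewrite /subword remE e1 e2 /del; congr (G _ _ _ _); lia.
Qed.

Lemma coef_ext D m p V c : (forall i, i \in D -> (i < m)%N) ->
  choice_ok eps D m p V c -> V != set0 ->
  coef (ext (eps m == Prime) m p V c) =
  (alpha ^+ c * q ^+ (above p V + c * 2 * below p V))%:C
  * (if eps m == Prime then 1
     else cip ip (embed (x m)) (recolor bar c (open_vector bar T x p V)))
  * coef p.
Proof.
move=> Dlt ch V0; rewrite /coef (scalar_weight_ext ip bar T x Dlt ch) (negPf V0) orbF.
rewrite (Narc_ext Dlt ch V0) (rc_MaxC_ext Dlt ch V0).
rewrite -[(_ + 2 * rnarc _ + _)%N]addnA -mulnDr (rnarc_MaxL_ext Dlt ch V0).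
(* The factor 2 in c * 2 * below comes from the exponents 2 rnarc and 2 MaxL. *)
set y := (if _ then _ else _).
have -> : (rc p + MaxC p + above p V + 2 * (rnarc p + MaxL p + c * below p V)
  = (above p V + c * 2 * below p V) + (rc p + MaxC p + 2 * rnarc p + 2 * MaxL p))%N by ring.
rewrite exprD [q ^+ (_ + _ + (_))]exprD [alpha ^+ _ * _]mulrC mulrACA.
by rewrite rmorphM /= mulrACA !mulrA.
Qed.

Lemma size_word D p V : stage eps D p -> V \in open_blocks p ->
  (size (word p)).-1 = (above p V + below p V)%N.
Proof.
by move=> st Vo; rewrite size_map; have [_ ->] := index_open_order st Vo; lia.
Qed.

(** The coefficients of the operators are the increments of the statistics:
    alpha q ^ (N - 1) q ^ (k - 1) is alpha q ^ (above + 2 below), as above +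
    below is N - 1. *)
Lemma b_op_stage D m : (forall i, i \in D -> (i < m)%N) ->
  b_op ip bar T alpha q (eps m) (x m) (\sum_(p | stage eps D p) term p)
  = \sum_(p | stage eps (m |: D) p) term p.
Proof.
move=> Dlt; rewrite (sum_stage eps Dlt).
rewrite (sum_choice eps D m (fun p V c => term (ext (eps m == Prime) m p V c))).
rewrite (linear_sumZ _ _ _ (@b_op_linear _ _ _ _ _ _ _ _ _)); apply: eq_bigr => p st.
have chV V c : eps m != Star -> V \in open_blocks p -> choice_ok eps D m p V c.
  by move=> /negPf mS Vo; rewrite /choice_ok st mS.
have V0 V : V \in open_blocks p -> V != set0.
  case/stageP: (st) => pP _ _ _ /(open_blocks_sub st); exact: (partition_neq0 pP).
rewrite /tensor_weight -/(open_order p) -/(word p).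
case E: (eps m) => /=.
- rewrite annihilation_tens /annihilation_word.
  rewrite (@word_sum D p _ (fun ab be h w =>
    ((q ^+ ab)%:C * cip ip (embed (x m)) h) *: tens w)) //.
  rewrite (@word_sum D p _ (fun ab be h w =>
    ((q ^+ be)%:C * cip ip (embed (x m)) (bar h)) *: tens w)) //.
  rewrite [X in _ + X]scaler_sumr -big_split scaler_sumr /=.
  apply: eq_bigr => V Vo; rewrite big_bool /= addrC scalerDr.
  have h c : term (ext false m p V c) =
    coef p *: (((alpha ^+ c * q ^+ (above p V + c * 2 * below p V))%:C
      * cip ip (embed (x m)) (recolor bar c (open_vector bar T x p V)))
      *: tens (subword p V)).
    have ch : choice_ok eps D m p V c by apply: chV; rewrite ?E.
    have := coef_ext Dlt ch (V0 V Vo); have := tensor_weight_ext bar T x Dlt ch.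
    rewrite E (negPf (V0 V Vo)) /= /term => -> ->.
    by rewrite scalerA [RHS]/= mulrC.
  rewrite (h false) (h true).
  rewrite {h} mul1n mul0n addn0.
  rewrite [alpha ^+ false]expr0 mul1r.
  rewrite [_%:C *: (_ *: _)]scalerA mulrA (size_word st Vo) -rmorphM -mulrA -exprD.
  by rewrite [alpha ^+ true]expr1 -addnA addnn mul2n.
- have ch : choice_ok eps D m p set0 false by rewrite /choice_ok st E !eqxx.
  have [[e1 e2 e3 e4] e5] := stats_star Dlt ch erefl.
  rewrite creation_tens /creation_word.
  have := tensor_weight_ext bar T x Dlt ch; have := scalar_weight_ext ip bar T x Dlt ch.
  move: e1 e2 e3 e4 e5; rewrite E /= eqxx mul1r /term /coef => -> -> -> -> -> -> ->.
  by rewrite rem_id // mem_open_order; apply/negP => /V0; rewrite eqxx.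
- rewrite gauge_tens /gauge_word.
  rewrite (@word_sum D p _ (fun ab be h w =>
    (q ^+ ab)%:C *: tens (rcons w (T (x m) h)))) //.
  rewrite (@word_sum D p _ (fun ab be h w =>
    (q ^+ be)%:C *: tens (rcons w (T (x m) (bar h))))) //.
  rewrite [X in _ + X]scaler_sumr -big_split scaler_sumr /=.
  apply: eq_bigr => V Vo; rewrite big_bool /= addrC scalerDr.
  have h c : term (ext true m p V c) =
    coef p *: ((alpha ^+ c * q ^+ (above p V + c * 2 * below p V))%:C
      *: tens (rcons (subword p V)
           (T (x m) (recolor bar c (open_vector bar T x p V))))).
    have ch : choice_ok eps D m p V c by apply: chV; rewrite ?E.
    have := coef_ext Dlt ch (V0 V Vo); have := tensor_weight_ext bar T x Dlt ch.
    rewrite E (negPf (V0 V Vo)) /= /term => -> ->.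
    by rewrite scalerA mulr1 mulrC.
  rewrite (h false) (h true).
  rewrite {h} mul1n mul0n addn0.
  rewrite [alpha ^+ false]expr0 mul1r.
  rewrite [_%:C *: (_ *: _)]scalerA (size_word st Vo) -rmorphM -mulrA -exprD.
  by rewrite [alpha ^+ true]expr1 -addnA addnn mul2n.
Qed.

End Step.

(** * The whole product *)

Lemma stage0 (n : nat) (eps : 'I_n -> letter) :
  stage eps set0 =1 pred1 (EPart set0 set0 set0).
Proof.
move=> p; apply/idP/eqP => [/stageP [pP hN hM _]|->]; last first.
  apply/stageP; split=> /= [|a|B|B i]; rewrite ?inE //.
  by rewrite /partition /cover big_set0 eqxx /finset.trivIset /cover !big_set0 cards0 inE.
have b0 : blocks p = set0.
  apply/setP => B; rewrite [RHS]inE; apply/negP => BP.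
  by have /set0Pn [i /(partition_mem pP BP)] := partition_neq0 pP BP; rewrite inE.
case: p pP hN hM b0 => P N M /= _ hN hM P0; rewrite P0 in hN hM *; congr EPart.
  by apply/setP => a; rewrite [RHS]inE; apply/negP => /hN /arcsP [B []]; rewrite inE.
by apply/setP => B; rewrite [RHS]inE; apply/negP => /hM []; rewrite inE.
Qed.

Theorem theorem3 (R : realType) (HR : completeNormedModType R)
  (ip : {dot HR for idfun})
  (ip_norm : forall u : HR, `|u| = Num.sqrt (ip u u))
  (HR_separable : exists D : set HR, countable D /\ dense D)
  (bar : {linear complexification HR -> complexification HR})
  (bar_bounded : bounded_op ip bar)
  (bar_selfadjoint : selfadjoint_op ip bar)
  (bar_involutive : forall h, bar (bar h) = h)
  (T : HR -> {linear complexification HR -> complexification HR})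
  (T_bounded : forall u, bounded_op ip (T u))
  (T_selfadjoint : forall u, selfadjoint_op ip (T u))
  (alpha q : R) (alpha_bounds : -1 < alpha < 1) (q_bounds : -1 < q < 1)
  (n : nat) (n_ge1 : (1 <= n)%N)
  (x : 'I_n -> HR) (eps : 'I_n -> letter) :
  foldl (fun t i => b_op ip bar T alpha q (eps i) (x i) t)
        (vacuum (complexification HR)) (enum 'I_n)
  = \sum_(p in compatible_partitions eps)
      ((alpha ^+ Narc p
        * q ^+ (rc p + MaxC p + 2 * rnarc p + 2 * MaxL p))%:C
       * scalar_weight ip bar T x p) *: tensor_weight bar T x p.
Proof.
set f := fun t i => _.
(* The index set is exhausted one element at a time; the hypothesis of the
   induction is the closed formula after k letters. *)
have key k : (k <= n)%N -> foldl f (vacuum _) (take k (enum 'I_n))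
    = \sum_(p | stage eps [set i : 'I_n | (i < k)%N] p) term ip bar T alpha q x p.
  elim: k => [_|k IH kn].
    have -> : [set i : 'I_n | (i < 0)%N] = set0 by apply/setP => i; rewrite !inE.
    rewrite take0 /= (big_pred1 _ (stage0 eps)) /term /coef.
    set p := EPart _ _ _; have st : stage eps set0 p by rewrite stage0 /= eqxx.
    have /stageP [pP hN _ _] := st.
    have A0 : arcs (blocks p) = set0.
      by apply/setP => a; rewrite [RHS]inE; apply/negP => /arcsP [B []]; rewrite inE.
    have O0 : open_blocks p = set0 by apply/setP => B; rewrite (open_blocksE _ st) !inE.
    have U0 : unmarked p = set0 by apply/setP => B; rewrite !inE.
    rewrite /Narc (rcE pP) (rnarcE pP) ?sub0set // MaxCE MaxLE A0 O0 !big_set0 cards0.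
    rewrite /scalar_weight U0 big_set0 expr0 mulr1 mul1r scale1r.
    by rewrite /tensor_weight O0 enum_set0.
  have kn' : (k < size (enum 'I_n))%N by rewrite size_enum_ord.
  set m := Ordinal kn.
  rewrite (take_nth m) // foldl_rcons (IH (ltnW kn)).
  have -> : nth m (enum 'I_n) k = m by apply/val_inj; rewrite /= nth_enum_ord.
  have -> : [set i : 'I_n | (i < k.+1)%N] = m |: [set i : 'I_n | (i < k)%N].
    by apply/setP => i; rewrite !inE ltnS leq_eqVlt.
  by apply: b_op_stage => i; rewrite inE.
have := key n (leqnn n); rewrite take_oversize ?size_enum_ord // => ->.
apply: eq_bigl => p; rewrite compatible_stage.
by congr (stage eps _ p); apply/setP => i; rewrite !inE ltn_ord.
Qed.
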